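(* Let $m,n\ge 1$ be integers. Let $X(s)=(X_1(s),\dots,X_m(s))\in\mathbb{R}^m$, $s\in[0,1]$, be a zero mean Gaussian process such that $$\mathrm{Cov}(X_i(s),X_j(t))=f(s,t)\,\delta_{ij}\qquad\text{for all } s,t\in[0,1],\ i,j\in\{1,\dots,m\},$$ for some (jointly) continuous function $f:[0,1]\times[0,1]\to\mathbb{R}$. Let $Q(x)=\sum_{\alpha\in\mathbb{N}_0^m}q_\alpha x^\alpha$ be a polynomial in $m$ variables with real coefficients (only finitely many $q_\alpha$ are nonzero). Fix a set $\{v_1,\dots,v_n\}$ of $n$ distinct vertices. Then $$\int_{\{0\le s_1\le\dots\le s_n\le 1\}}\mathbb{E}\left[\prod_{k=1}^n Q(X(s_k))\right]\mathrm{d}s_1\cdots\mathrm{d}s_n$$ $$=\frac{1}{n!}\sum_{\substack{\alpha^{(1)},\dots,\alpha^{(n)}\in\mathbb{N}_0^m\\ \sum_{k=1}^n\sum_{i=1}^m\alpha_i^{(k)}\ \text{even}}}\left(\prod_{k=1}^n q_{\alpha^{(k)}}\right)\sum_{\Gamma_1}\cdots\sum_{\Gamma_m}\left(\prod_{q=1}^m C(\Gamma_q)\right)\left(\prod_{\Lambda\in\mathscr{C}(\Gamma_1+\cdots+\Gamma_m)}\int_\Lambda f\right),$$ where, for each $q\in\{1,\dots,m\}$, the sum over $\Gamma_q$ runs over all multigraphs $\Gamma_q$ with vertex set $\{v_1,\dots,v_n\}$ such that the degree of $v_j$ in $\Gamma_q$ equals $\alpha_q^{(j)}$ for all $j\i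n\{1,\dots,n\}$.
   Context: Notation: $\mathbb{N}_0=\{0,1,2,\dots\}$; for $x\in\mathbb{R}^m$ and $\alpha\in\mathbb{N}_0^m$, $x^\alpha=x_1^{\alpha_1}\cdots x_m^{\alpha_m}$. Empty products equal $1$ and empty sums equal $0$. Multigraphs: A multigraph (undirected, finite, with loops allowed) $\Gamma$ is a set $V$ of vertices together with an edge-multiplicity function $h:\{\{v,w\}:v,w\in V\}\to\mathbb{N}_0$ (the domain includes the singletons $\{v\}$; $h(\{v\})$ is the number of loops at $v$). Here multigraphs are labeled: two multigraphs on the same vertex set are equal iff their functions $h$ are equal. The degree of a vertex is $\deg(v)=2h(\{v\})+\sum_{w\in V\setminus\{v\}}h(\{v,w\})$. Components: $\Gamma$ is connected if any two distinct vertices $a\neq b$ are joined by a path of edges of multiplicity at least $1$. A sub-multigraph of $\Gamma$ consists of a subset $V'\subset V$ together with the restriction of $h$ to $\{\{v,w\}:v,w\in V'\}$. A connected component is a connected sub-multigraph that is not a sub-multigraph of any other connected sub-multigraph, and $\mathscr{C}(\Gamma)$ is the set of connected components of $\Gamma$. Sum: for multigraphs $\Gamma_1,\Gamma_2$ with the same vertex set and edge-multiplicity functions $h_1,h_2$, $\Gamma_1+\Gamma_2$ is the multigraph with the same vertex set and edge-multiplicity function $h_1+h_2$. Integral along a multigraph: for a symmetric function $f:[0,1]\times[0,1]\to\mathbb{R}$ and a multigraph $\Gamma$ with vertices $w_1,\dots,w_l$ and edge-multiplicity function $h$, $$\int_\Gamma f:=\int_{[0,1]^l}\prod_{1\le a\le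 b\le l}f(s_a,s_b)^{h(\{w_a,w_b\})}\,\mathrm{d}s_1\cdots\mathrm{d}s_l$$ (with the convention $y^0=1$ for all real $y$). Symmetry factor: for a multigraph $\Gamma$ with vertices $w_1,\dots,w_l$ and edge-multiplicity function $h$, $$C(\Gamma):=\frac{\prod_{a=1}^l \deg(w_a)!}{2^{\sum_{a=1}^l h(\{w_a\})}\prod_{1\le a\le b\le l}h(\{w_a,w_b\})!}.$$ *)

(* Defs.v *)
From HB Require Import structures.
From mathcomp Require Import all_boot all_order all_algebra.
From mathcomp Require mpoly.
From mathcomp Require Import all_classical all_reals all_analysis.

Set Implicit Arguments.
Unset Strict Implicit.
Unset Printing Implicit Defensive.

Import Order.TTheory GRing.Theory Num.Theory.
Import numFieldNormedType.Exports.

Local Open Scope classical_set_scope.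
Local Open Scope ring_scope.

Section Multigraph.

(* The unordered pairs {v, w}, the singletons {v} = {v, v} included. *)
Definition edge (V : finType) : Type :=
  {E : {set V} | E \in [set [set p.1; p.2] | p : V * V]%SET}.

Lemma pair_is_edge (V : finType) (v w : V) :
  [set v; w]%SET \in [set [set p.1; p.2] | p : V * V]%SET.
Proof. by apply/imsetP; exists (v, w). Qed.

Definition pair_edge (V : finType) (v w : V) : edge V :=
  exist _ [set v; w]%SET (pair_is_edge v w).

Lemma image_is_edge (U V : finType) (i : U -> V) (E : edge U) :
  (i @: val E)%SET \in [set [set p.1; p.2] | p : V * V]%SET.
Proof.
case: E => /= E /imsetP[[u v] _ ->] /=.
by apply/imsetP; exists (i u, i v) => //; rewrite imsetU !imset_set1.
Qed.

Definition image_edge (U V : finType) (i : U -> V) (E : edge U) : edge V :=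
  exist _ (i @: val E)%SET (image_is_edge i E).

End Multigraph.

(* A multigraph is its edge-multiplicity function; the sum of multigraphs is
   the pointwise addition of {ffun _ -> nat}. *)
Notation multigraph V := {ffun edge V -> nat}.

Section MultigraphTheory.
Variables (V : finType) (G : multigraph V).

Definition mult (v w : V) : nat := G (pair_edge v w).

Definition degree (v : V) : nat :=
  (2 * mult v v + \sum_(w | w != v) mult v w)%N.

Definition adjacent : rel V := [rel v w | (0 < mult v w)%N].

Definition mg_connected : bool :=
  [forall a, forall b, (a != b) ==> connect adjacent a b].

Definition submultigraph (A : {set V}) : multigraph {v : V | v \in A} :=
  [ffun E => G (image_edge val E)].

End MultigraphTheory.

(* A sub-multigraph is determined by its vertex set. *)
Definition components (V : finType) (G : multigraph V) : {set {set V}} :=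
  [set A | maxset (fun B => mg_connected (submultigraph G B)) A]%SET.

Section SymmetryFactor.
Variables (R : realType) (V : finType) (G : multigraph V).

Definition symmetry_factor : R :=
  (\prod_(v : V) (degree G v)`!)%N%:R /
  (2 ^ (\sum_(v : V) mult G v v) *
   \prod_(a < #|V|) \prod_(b < #|V| | (a <= b)%N)
     (mult G (enum_val a) (enum_val b))`!)%N%:R.

End SymmetryFactor.

Section MeasureSigmaFiniteBundle.
Context d (T : measurableType d) (R : realType).
Variables (m : {measure set T -> \bar R}) (sm : sigma_finite setT m).

Let bundle (_ : sigma_finite setT m) : set T -> \bar R := m.
HB.instance Definition _ := Measure.on (bundle sm).
HB.instance Definition _ := Measure_isSigmaFinite.Build _ _ _ (bundle sm) sm.

Lemma measure_sigma_finite_bundle :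
  exists m' : {sigma_finite_measure set T -> \bar R},
    (m : set T -> \bar R) = m'.
Proof. by exists (bundle sm). Qed.

End MeasureSigmaFiniteBundle.

Section ProductPushforward.
Context d1 d2 d3 (T1 : measurableType d1) (T2 : measurableType d2)
  (T3 : measurableType d3) (R : realType).
Variables (m1 : {sigma_finite_measure set T1 -> \bar R})
  (m2 : {sigma_finite_measure set T2 -> \bar R}).
Variables (phi : T1 * T2 -> T3) (psi : T3 -> T1 * T2).
Hypotheses (mphi : measurable_fun setT phi) (mpsi : measurable_fun setT psi).
Hypothesis phiK : cancel phi psi.

Lemma product_pushforward_sigma_finite :
  exists m : {sigma_finite_measure set T3 -> \bar R},
    pushforward (m1 \x m2)%E phi = m.
Proof.
pose mm : {measure set T3 -> \bar R} :=
  measure_function_pushforward__canonical__measure_function_Measure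
    (lebesgue_integral_fubini_product_measure1__canonical__measure_function_Measure
       m1 m2) mphi.
have smm : sigma_finite setT mm.
  have /sigma_finiteP[F [TF ndF Foo]] := sigma_finiteT m1.
  have /sigma_finiteP[G [TG ndG Goo]] := sigma_finiteT m2.
  exists (fun k => psi @^-1` (F k `*` G k)).
    rewrite -preimage_bigcup (_ : \bigcup_i _ = setT) ?preimage_setT //.
    apply/seteqP; split=> // -[x y] _.
    have [i _ Fix] : (\bigcup_i F i) x by rewrite -TF.
    have [j _ Gjy] : (\bigcup_i G i) y by rewrite -TG.
    exists (maxn i j) => //; split=> /=.
    - by move: x Fix; exact/subsetPset/ndF/leq_maxl.
    - by move: y Gjy; exact/subsetPset/ndG/leq_maxr.
  move=> k; have [mF Fk] := Foo k; have [mG Gk] := Goo k; split.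
    by rewrite -[X in measurable X]setTI; apply: mpsi => //; exact: measurableX.
  rewrite /mm /= /pushforward -comp_preimage.
  rewrite (_ : psi \o phi = id); last by apply/funext => x /=; rewrite phiK.
  rewrite preimage_id.
  by rewrite product_measure1E// lte_mul_pinfty// ge0_fin_numE.
exact: (measure_sigma_finite_bundle smm).
Qed.

End ProductPushforward.

Section LebesgueTuple.
Variable R : realType.
Local Open Scope ereal_scope.
Local Notation RT := (measurableTypeR R).

Definition cons_pair n (p : RT * n.-tuple RT) : n.+1.-tuple RT :=
  [tuple of p.1 :: p.2].

Fixpoint lebesgue_tuple (n : nat) : set (n.-tuple RT) -> \bar R :=
  match n with
  | 0 => \d_([tuple] : 0.-tuple RT)
  | k.+1 => pushforward (@lebesgue_measure R \x @lebesgue_tuple k)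
                        (@cons_pair k)
  end.

Lemma measurable_cons_pair n : measurable_fun setT (@cons_pair n).
Proof.
exact: (@measurable_cons _ _ _ _ (fst : RT * n.-tuple RT -> RT) n snd).
Qed.

Lemma lebesgue_tuple_sigma_finite n :
  exists m : {sigma_finite_measure set (n.-tuple RT) -> \bar R},
    @lebesgue_tuple n = m.
Proof.
elim: n => [|n [m mE]]; first by exists (\d_([tuple] : 0.-tuple RT)).
rewrite /= mE.
apply: (@product_pushforward_sigma_finite _ _ _ _ _ _ R lebesgue_measure m _
  (fun t => (thead t, [tuple of behead t]))).
- exact: measurable_cons_pair.
- apply: measurable_fun_pair; first exact: measurable_tnth.
  exact: measurable_behead.
- move=> [x t]; rewrite /cons_pair /=; congr (_, _); exact/val_inj.
Qed.

Let lebesgue_tuple0 n : @lebesgue_tuple n set0 = 0.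
Proof. by have [m ->] := lebesgue_tuple_sigma_finite n. Qed.

Let lebesgue_tuple_ge0 n A : 0 <= @lebesgue_tuple n A.
Proof. by have [m ->] := lebesgue_tuple_sigma_finite n. Qed.

Let lebesgue_tuple_sigma_additive n :
  semi_sigma_additive (@lebesgue_tuple n).
Proof.
have [m ->] := lebesgue_tuple_sigma_finite n.
exact: measure_semi_sigma_additive.
Qed.

HB.instance Definition _ n := isMeasure.Build _ _ _ (@lebesgue_tuple n)
  (lebesgue_tuple0 n) (@lebesgue_tuple_ge0 n)
  (@lebesgue_tuple_sigma_additive n).

Let lebesgue_tuple_sigma_finiteT n : sigma_finite setT (@lebesgue_tuple n).
Proof.
by have [m ->] := lebesgue_tuple_sigma_finite n; exact: sigma_finiteT.
Qed.

HB.instance Definition _ n := Measure_isSigmaFinite.Build _ _ _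
  (@lebesgue_tuple n) (lebesgue_tuple_sigma_finiteT n).

End LebesgueTuple.
Arguments lebesgue_tuple {R} n.


Section IntegralAlong.
Variable R : realType.

Definition unit_cube (n : nat) : set (n.-tuple (measurableTypeR R)) :=
  [set s | forall i, tnth s i \in `[0, 1]].

Definition ordered_simplex (n : nat) : set (n.-tuple (measurableTypeR R)) :=
  [set s | unit_cube s /\
           forall i j : 'I_n, (i <= j)%N -> tnth s i <= tnth s j].

Definition integral_along (V : finType) (f : R * R -> R) (G : multigraph V) :
    R :=
  \int[lebesgue_tuple #|V|]_(s in @unit_cube #|V|)
    \prod_(a < #|V|) \prod_(b < #|V| | (a <= b)%N)
      f (tnth s a, tnth s b) ^+ mult G (enum_val a) (enum_val b).

End IntegralAlong.

Section Gaussian.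
Context d (T : measurableType d) (R : realType) (P : probability T R).

(* The degenerate law must be separated: normal_prob m 0 is not the Dirac
   measure at m. *)
Definition gaussian_law (m s : R) (A : set (measurableTypeR R)) : \bar R :=
  if s == 0 then \d_m A else normal_prob m s A.

Definition gaussian_rv (Y : T -> R) : Prop :=
  exists m s, forall A : set (measurableTypeR R), measurable A ->
    P (Y @^-1` A) = gaussian_law m s A.

(* The finite-dimensional marginals of the R^m-valued process are
   multivariate Gaussian, i.e. all their linear functionals are Gaussian. *)
Definition gaussian_process (m : nat) (D : set R)
    (X : 'I_m -> R -> {RV P >-> R}) : Prop :=
  forall (k : nat) (t : 'I_k -> R) (c : 'I_k -> 'I_m -> R),
    (forall j, D (t j)) ->
    gaussian_rv (fun w => \sum_(j < k) \sum_(i < m) c j i * X i (t j) w).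

End Gaussian.

(* Main.v *)
(** The variables X_i(s_k) are jointly Gaussian, so a linear combination Y with
    coefficients c is centered Gaussian and its variance v(c) is a quadratic form
    in c; completing the square gives its moment generating function, hence
    E[Y^(2p)] / (2p)! = (v(c) / 2)^p / p!, the odd moments being 0.  Expand both
    sides by the multinomial theorem and compare the coefficients of the
    monomials in c: on the right a monomial is a choice of multiplicities for the
    terms of v(c), that is a multigraph for each component X_q, the exponent of
    c_(q,k) is the degree of the k-th vertex in the q-th multigraph, and the
    coefficient is the symmetry factor.  This is Wick's formula.

    The integrand is symmetric in the times, so the simplex contributes 1/n! of
    the cube, ties being negligible; over the cube the product over the edges
    splits by Fubini along the connected components. *)
Require Import Defs.
From mathcomp Require Import all_boot all_order all_algebra.
From mathcomp Require mpoly.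
From mathcomp Require Import fingroup perm.
From mathcomp Require Import ring lra.
From mathcomp Require Import all_classical all_reals all_analysis.
From mathcomp Require Import measurable_realfun.

Set Implicit Arguments.
Unset Strict Implicit.
Unset Printing Implicit Defensive.

Import -(notations) mpoly.
Import Order.TTheory GRing.Theory Num.Theory.
Import numFieldNormedType.Exports.

Local Open Scope classical_set_scope.
Local Open Scope ring_scope.

(** * Moments of Gaussian variables *)

(** Wick's formula is proved at a fixed choice of times, with covariances attached to edges between
    abstract vertices, so coinciding times need no separate treatment. The index sets are an
    obstacle: the exponents and multigraphs of the statement range over infinite types. Since [Q]
    has finite support and degrees bound multiplicities, both are encoded by functions into
    ordinals.

    A point of the cube is a function [V -> R] rather than a tuple, so permuting times or grouping
    them by component becomes a matter of lists of names; the link with [lebesgue_tuple] is made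
    once, in [integral_lebesgue_tuple]. No measure is put on [V -> R]: measurability is expressed by
    [nice], and the null set of ties is handled by an explicit function of integral zero that
    dominates the error. *)

Section Density.
Context {R : realType}.
Local Notation mu := (@lebesgue_measure R).
Local Open Scope ereal_scope.

(** The density agrees almost everywhere with the Radon-Nikodym derivative of [normal_prob m s],
    since both integrate to the same mass on every measurable set. *)
Lemma ge0_integral_normal_prob (m s : R) (f : measurableTypeR R -> \bar R) :
  measurable_fun setT f -> (forall x, 0 <= f x) ->
  \int[normal_prob m s]_x f x = \int[mu]_x (f x * (normal_pdf m s x)%:E).
Proof.
move=> mf f0; have dom := normal_prob_dominates m s.
rewrite -(@Radon_Nikodym_SigmaFinite.change_of_variables _ _ _
  (normal_prob m s) mu dom)//.
have mg : measurable_fun setT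
    (Radon_Nikodym_SigmaFinite.f (normal_prob m s) mu).
  exact: measurable_int (Radon_Nikodym_SigmaFinite.f_integrable dom).
have mp : measurable_fun setT (fun x => (normal_pdf m s x)%:E).
  by apply/measurable_EFinP; exact: measurable_normal_pdf.
apply: ae_eq_integral => //; try exact: emeasurable_funM.
apply: ae_eqe_mul2l; apply: integral_ae_eq => //.
  exact: Radon_Nikodym_SigmaFinite.f_integrable.
by move=> E E01 mE; rewrite -Radon_Nikodym_SigmaFinite.f_integral.
Qed.

(* Completing the square turns the integrand into a constant times the density
   with mean [m + t * s ^+ 2]. *)
Lemma normal_exp_moment (m s t : R) : s != 0%R ->
  \int[normal_prob m s]_x (expR (t * (x - m)))%:E =
  (expR (t ^+ 2 * s ^+ 2 / 2))%:E.
Proof.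
move=> s0; rewrite ge0_integral_normal_prob; last 2 first.
- apply/measurable_EFinP; apply: measurableT_comp => //.
  by apply: measurable_funM => //; exact: measurable_funB.
- by move=> x; rewrite lee_fin expR_ge0.
transitivity (\int[mu]_x ((expR (t ^+ 2 * s ^+ 2 / 2))%:E *
   (normal_pdf (m + t * s ^+ 2) s x)%:E)).
  apply: eq_integral => x _; rewrite -!EFinM; congr EFin.
  rewrite !normal_pdfE// mulrCA [RHS]mulrCA; congr (_ * _)%R.
  rewrite /normal_fun -!expRD; congr expR.
  by field.
rewrite ge0_integralZl//.
- by rewrite integral_normal_pdf mule1.
- by apply/measurable_EFinP; exact: measurable_normal_pdf.
- by move=> x _; rewrite lee_fin normal_pdf_ge0.
Qed.

End Density.

Section PowerSeries.
Context {R : realType}.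

(** Convergence at [t = 1] makes the coefficients tend to 0, hence bounds them by some [M]. Once the
    coefficients before [n] vanish, the terms beyond degree [n] sum to at most
    [t ^+ n * (M * t / (1 - t))]; dividing by [t ^+ n] and taking [t] small forces [c n = 0]. *)
Lemma power_series_eq0 (c : R^nat) :
  (forall t, (\sum_(n < N) c n * t ^+ n) @[N --> \oo] --> (0 : R)) ->
  forall n, c n = 0.
Proof.
move=> c0 n; have [k] := ubnP n; elim: k n => // k IH n; rewrite ltnS => nk.
have {}IH i : (i < n)%N -> c i = 0 by move=> iN; apply: IH; exact: leq_trans nk.
have c1 : c @ \oo --> (0 : R).
  have h1 := c0 1.
  have h2 : (\sum_(n < N.+1) c n * 1 ^+ n) @[N --> \oo] --> (0 : R).
    by rewrite (cvg_shiftS (fun N => \sum_(n < N) c n * 1 ^+ n)).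
  have -> : c = (fun N => \sum_(n < N.+1) c n * 1 ^+ n - \sum_(n < N) c n * 1 ^+ n).
    apply/funext => N; rewrite big_ord_recr/= expr1n mulr1 addrAC subrr.
    by rewrite add0r.
  by rewrite -[X in _ --> X](subr0 0); exact: cvgB h2 h1.
have [M [M0 cM]] : exists M : R, 0 < M /\ forall i, `|c i| <= M.
  have [M [Mr HM]] := cvg_seq_bounded (cvgP _ c1).
  exists (`|M| + 1); split; first by rewrite ltr_wpDl.
  by move=> i; apply: HM => //; rewrite (le_lt_trans (ler_norm M))// ltrDl.
suff small (e : R) : 0 < e -> `|c n| <= e.
  by apply/eqP; rewrite -normr_le0; apply/ler_addgt0Pl => e /small; rewrite addr0.
(* This [t] solves [M * t / (1 - t) = e / 2]: the tail takes half of the allowed error and the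
   partial sum, eventually, the other half. *)
move=> e0; pose t : R := e / (2 * M + e).
have Me : 0 < 2 * M + e by rewrite addr_gt0// mulr_gt0.
have t0 : 0 < t by rewrite divr_gt0.
have t1 : t < 1 by rewrite ltr_pdivrMr// mul1r ltrDr mulr_gt0.
have et : e / 2 = M * t / (1 - t) by rewrite /t; field; rewrite ?gt_eqF//=; nra.
move: t t0 t1 et => t t0 t1 et {Me}.
have key N : (n < N)%N ->
    `|c n| * t ^+ n <= `|\sum_(i < N) c i * t ^+ i| + t ^+ n * (e / 2).
  move=> nN; rewrite -(subnKC nN) big_split_ord/= big_ord_recr/=.
  rewrite big1 ?add0r; last by move=> i _; rewrite IH ?mul0r.
  set S := \sum_(i < _) _.
  have HS : `|S| <= t ^+ n * (e / 2).
    apply: (@le_trans _ _ (\sum_(i < N - n.+1) M * t ^+ n.+1 * t ^+ i)).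
      rewrite (le_trans (ler_norm_sum _ _ _))// ler_sum// => i _.
      rewrite normrM normrX (gtr0_norm t0) exprD mulrA.
      by do 2 (apply: ler_wpM2r; first exact: exprn_ge0 (ltW t0)).
    rewrite -mulr_sumr.
    have u0 : 0 < 1 - t by rewrite subr_gt0.
    have geo : \sum_(i < N - n.+1) t ^+ i = (1 - t ^+ (N - n.+1)) / (1 - t).
      have un : 1 - t != 0 by rewrite gt_eqF.
      rewrite -[LHS](mulfK un).
      by congr (_ / _); rewrite -(opprB t) mulrN mulrC -subrX1 opprB.
    rewrite geo et -subr_ge0 exprS.
    have -> : t ^+ n * (M * t / (1 - t)) -
        M * (t * t ^+ n) * ((1 - t ^+ (N - n.+1)) / (1 - t)) =
        M * t * t ^+ n * t ^+ (N - n.+1) / (1 - t) by field; rewrite gt_eqF.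
    by rewrite !mulr_ge0 ?invr_ge0 ?exprn_ge0 ?(ltW t0) ?(ltW M0) ?(ltW u0).
  rewrite -[X in _ * X](gtr0_norm (exprn_gt0 n t0)) -normrM.
  have := ler_normB (c n * t ^+ n + S) S.
  by rewrite addrK => h; apply: (le_trans h); rewrite lerD2l.
have tn0 : 0 < t ^+ n * (e / 2) by rewrite mulr_gt0 ?exprn_gt0 ?divr_gt0.
have /cvgr0Pnorm_lt/(_ _ tn0)[N0 _ HN0] := c0 t.
have := key (maxn n.+1 N0) (leq_maxl _ _).
have := HN0 (maxn n.+1 N0) (leq_maxr _ _) => /=.
move=> h1 h2; rewrite -(ler_pM2r (exprn_gt0 n t0)).
apply: (le_trans h2); lra.
Qed.

End PowerSeries.

Section Moments.
Context {R : realType}.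

Lemma exp_partial_sum_le (x : R) N : 0 <= x ->
  \sum_(n < N) x ^+ n / n`!%:R <= expR x.
Proof.
move=> x0; rewrite -(big_mkord xpredT (fun n => x ^+ n / n`!%:R)).
have nd : nondecreasing_seq (series (exp_coeff x)).
  by apply: nondecreasing_series => n _ _; exact: exp_coeff_ge0.
exact: nondecreasing_cvgn_le nd (is_cvg_series_exp_coeff x) N.
Qed.

Lemma exp_partial_sum_cvg (x : R) :
  (\sum_(n < N) x ^+ n / n`!%:R) @[N --> \oo] --> expR x.
Proof.
have := is_cvg_series_exp_coeff x; rewrite -/(expR x) => /cvg_ex[l h].
have -> : expR x = l by exact/cvg_lim.
by under eq_fun do rewrite -(big_mkord xpredT (fun n => x ^+ n / n`!%:R)).
Qed.

Lemma expR_norm_le (x : R) : expR `|x| <= expR x + expR (- x).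
Proof.
have [x0|x0] := ger0P x; first by rewrite lerDl expR_ge0.
by rewrite lerDr expR_ge0.
Qed.

Lemma exprn_le_fact_expR (x : R) N : `|x| ^+ N <= N`!%:R * expR `|x|.
Proof.
rewrite -ler_pdivrMl ?ltr0n ?fact_gt0// mulrC.
apply: le_trans (exp_partial_sum_le N.+1 (normr_ge0 x)).
by rewrite big_ord_recr/= lerDr sumr_ge0.
Qed.

(* [E[Y ^+ N] / N`!] for a centered Gaussian [Y] of variance [v]. *)
Definition gaussian_moment (N : nat) (v : R) : R :=
  if odd N then 0 else (v / 2) ^+ N./2 / (N./2)`!%:R.

(** The even numbers below [N] are the [2 * p] with [p < uphalf N], and the term of degree [2 * p]
    is the [p]-th term of the exponential series at [t ^+ 2 * v / 2]. *)
Lemma gaussian_moment_sum (v t : R) N :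
  \sum_(n < N) gaussian_moment n v * t ^+ n =
  \sum_(p < uphalf N) (t ^+ 2 * v / 2) ^+ p / p`!%:R.
Proof.
elim: N => [|N IH]; first by rewrite !big_ord0.
rewrite big_ord_recr/= IH /gaussian_moment uphalf_half.
case: ifPn => oN; first by rewrite mul0r addr0 add1n.
rewrite add0n big_ord_recr/=; congr (_ + _).
rewrite -{3}(odd_double_half N) (negbTE oN) add0n -mul2n exprM.
by rewrite -mulrA (mulrC _ (_ ^+ N./2)) mulrA -exprMn; congr (_ ^+ _ / _); ring.
Qed.

Context d (T : measurableType d) (P : probability T R).

(** Dominated convergence integrates the exponential series of [t * W] term by term, so the moments
    divided by factorials are the Taylor coefficients of the generating function; [power_series_eq0]
    identifies them with [gaussian_moment]. *)
Lemma moments_of_mgf (W : T -> R) (v : R) : measurable_fun setT W ->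
  (forall t, \int[P]_w (expR (t * W w))%:E = (expR (t ^+ 2 * v / 2))%:E)%E ->
  (forall N, P.-integrable setT (fun w => (W w ^+ N)%:E)) /\
  (forall N, \int[P]_w (W w ^+ N)%:E = (N`!%:R * gaussian_moment N v)%:E)%E.
Proof.
move=> mW mgf.
have mX N : measurable_fun setT (fun w => W w ^+ N) by exact: measurable_funX.
have mE t : measurable_fun setT (fun w => expR (t * W w)).
  by apply: measurableT_comp => //; exact: measurable_funM.
have iE t : P.-integrable setT (fun w => (expR (t * W w))%:E).
  apply/integrableP; split; first exact/measurable_EFinP.
  under eq_integral do rewrite /= ger0_norm ?expR_ge0//.
  by rewrite mgf ltry.
(* This dominates the exponential of the absolute value of [t * W w], hence every partial sum of the
   series and, at [t = 1] and up to a factorial, every power of [W]. It is integrable because the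
   generating function is finite at both [t] and [- t]. *)
pose g t w := expR (t * W w) + expR (- (t * W w)).
have ig t : P.-integrable setT (fun w => (g t w)%:E).
  under eq_fun do rewrite /g EFinD -mulNr.
  by apply: integrableD => //; exact: iE.
have iX N : P.-integrable setT (fun w => (W w ^+ N)%:E).
  apply: (@le_integrable _ _ _ _ _ _ _ (fun w => N`!%:R%:E * (g 1 w)%:E)%E) => //.
  - exact/measurable_EFinP.
  - move=> w _; rewrite /= lee_fin normrX (le_trans (exprn_le_fact_expR _ _))//.
    rewrite [leRHS]ger0_norm ?mulr_ge0 ?addr_ge0 ?expR_ge0//.
    by rewrite ler_wpM2l// /g mul1r expR_norm_le.
  - exact: integrableZl.
split=> // N.
pose a n : R := fine (\int[P]_w (W w ^+ n)%:E).
have aE n : (\int[P]_w (W w ^+ n)%:E = (a n)%:E)%E.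
  by rewrite fineK//; exact: integrable_fin_num.
pose S t n w : R := \sum_(i < n) (t * W w) ^+ i / i`!%:R.
have SE t n : (\int[P]_w (S t n w)%:E = (\sum_(i < n) a i / i`!%:R * t ^+ i)%:E)%E.
  under eq_integral => w _.
    rewrite /S -sumEFin.
    under eq_bigr do rewrite exprMn mulrAC EFinM.
    over.
  rewrite integral_sum//; last by move=> i; exact: integrableZl.
  rewrite -sumEFin; apply: eq_bigr => i _.
  by rewrite integralZl// aE -EFinM; congr EFin; ring.
have ES t : (\sum_(i < n) a i / i`!%:R * t ^+ i) @[n --> \oo] -->
    expR (t ^+ 2 * v / 2).
  have mS n : measurable_fun setT (fun w => (S t n w)%:E).
    apply/measurable_EFinP; apply: measurable_sum => i.
    apply: measurable_funM => //; apply: measurable_funX.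
    exact: measurable_funM.
  have mEt : measurable_fun setT (fun w => (expR (t * W w))%:E).
    exact/measurable_EFinP.
  have cS : {ae P, forall w, setT w ->
      (S t n w)%:E @[n --> \oo] --> (expR (t * W w))%:E}.
    apply: aeW => w _; apply: cvg_EFin; first exact: nearW.
    exact: exp_partial_sum_cvg.
  have bS : {ae P, forall w n, setT w -> (`|(S t n w)%:E| <= (g t w)%:E)%E}.
    apply: aeW => w n _; rewrite /= lee_fin; apply: le_trans (expR_norm_le _).
    apply: le_trans (exp_partial_sum_le n (normr_ge0 _)).
    rewrite (le_trans (ler_norm_sum _ _ _))// ler_sum// => i _.
    by rewrite normrM normrX [`|_^-1|]ger0_norm.
  have [_ _] := dominated_convergence measurableT mS mEt cS (ig t) bS.
  rewrite mgf; under eq_fun do rewrite SE.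
  by move/fine_cvgP => [].
suff /(_ N) : forall n, a n / n`!%:R - gaussian_moment n v = 0.
  move/eqP; rewrite subr_eq0 => /eqP h; rewrite aE -h mulrC divfK//.
apply: (@power_series_eq0 _ (fun n => a n / n`!%:R - gaussian_moment n v)) => t.
have cG : (\sum_(i < n) gaussian_moment i v * t ^+ i) @[n --> \oo] -->
    expR (t ^+ 2 * v / 2).
  under eq_fun do rewrite gaussian_moment_sum.
  apply: (cvg_comp uphalf (fun n => \sum_(p < n) (t ^+ 2 * v / 2) ^+ p / p`!%:R));
    last exact: exp_partial_sum_cvg.
  apply/cvgnyPge => M; exists M.*2 => // n /= Mn.
  by rewrite geq_uphalf_double (leq_trans Mn).
have := cvgB (ES t) cG; rewrite subrr => h.
rewrite (_ : (fun N : nat => _) = (fun n => \sum_(i < n) a i / i`!%:R * t ^+ i)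
  - (fun n => \sum_(i < n) gaussian_moment i v * t ^+ i)).
  exact: h.
apply/funext => n; rewrite !fctE -sumrB.
by apply: eq_bigr => i _; rewrite mulrBl.
Qed.

End Moments.

Section GaussianRV.
Context {R : realType} d (T : measurableType d) (P : probability T R).
Variable Y : T -> R.
Hypothesis mY : measurable_fun setT Y.
Hypothesis gY : gaussian_rv P Y.

(** Passing to the generating function merges the degenerate law, where [v = 0], with the
    nondegenerate one; the case split does not reappear later. *)
Lemma gaussian_rv_mgf : exists m v, forall t,
  (\int[P]_w (expR (t * (Y w - m)))%:E = (expR (t ^+ 2 * v / 2))%:E)%E.
Proof.
have [m [s law]] := gY; exists m, (s ^+ 2) => t.
pose h (x : measurableTypeR R) := (expR (t * (x - m)))%:E.
have mh : measurable_fun setT h.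
  apply/measurable_EFinP; apply: measurableT_comp => //.
  by apply: measurable_funM => //; exact: measurable_funB.
have h0 x : (0 <= h x)%E by rewrite lee_fin expR_ge0.
transitivity (\int[pushforward P (Y : T -> measurableTypeR R)]_x h x)%E.
  by rewrite ge0_integral_pushforward.
have [s0|s0] := eqVneq s 0.
  rewrite (eq_measure_integral (@dirac _ (measurableTypeR R) m R)).
    rewrite integral_dirac// diracT mul1e /h subrr mulr0 s0.
    by rewrite expr0n/= mulr0 mul0r.
  by move=> A mA _; rewrite -[LHS]/(P (Y @^-1` A)) law// /gaussian_law s0 eqxx.
rewrite (eq_measure_integral (normal_prob m s)).
  exact: normal_exp_moment.
by move=> A mA _; rewrite -[LHS]/(P (Y @^-1` A)) law// /gaussian_law (negbTE s0).
Qed.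

(** The centered variable [Y - m] has all moments by [moments_of_mgf]; the binomial theorem
    transfers this to [Y]. *)
Lemma gaussian_rv_integrable N : P.-integrable setT (fun w => (Y w ^+ N)%:E).
Proof.
have [m [v mgf]] := gaussian_rv_mgf.
have mW : measurable_fun setT (fun w => Y w - m) by exact: measurable_funB.
have [iW _] := moments_of_mgf mW mgf.
have -> : (fun w => (Y w ^+ N)%:E) = (fun w => \sum_(i < N.+1)
    ((m ^+ (N - i) *+ 'C(N, i))%:E * ((Y w - m) ^+ i)%:E))%E.
  apply/funext => w; rewrite -{1}(subrK m (Y w)) addrC exprDn -sumEFin.
  by apply: eq_bigr => i _; rewrite -EFinM mulrnAl.
by apply: integrable_sum => // i _; exact: integrableZl.
Qed.

(** The parameters are read off from low moments: the vanishing first moment of [Y - m] gives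
    [m = 0], and [N = 2] gives the second moment as [2 * (v / 2) = v]. *)
Lemma gaussian_rv_moment N : (\int[P]_w (Y w)%:E = 0)%E ->
  (\int[P]_w (Y w ^+ N)%:E =
   (N`!%:R * gaussian_moment N (fine (\int[P]_w (Y w ^+ 2)%:E)))%:E)%E.
Proof.
move=> EY0; have [m [v mgf]] := gaussian_rv_mgf.
have mW : measurable_fun setT (fun w => Y w - m) by exact: measurable_funB.
have [iW EW] := moments_of_mgf mW mgf.
have m0 : m = 0.
  have := EW 1%N; rewrite /gaussian_moment/= mulr0.
  under eq_integral do rewrite expr1 EFinB.
  rewrite integralB//=.
  - have -> : (\int[P]__ m%:E = m%:E)%E by rewrite integral_cst//= probability_setT mule1.
    rewrite EY0 sub0e => -[] /eqP.
    by rewrite oppr_eq0 => /eqP.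
  - by apply: eq_integrable (gaussian_rv_integrable 1) => // w _; rewrite expr1.
  - exact: finite_measure_integrable_cst.
have {}EW k : (\int[P]_w (Y w ^+ k)%:E = (k`!%:R * gaussian_moment k v)%:E)%E.
  by rewrite -EW; apply: eq_integral => w _; rewrite m0 subr0.
rewrite !EW; congr (_ * gaussian_moment _ _)%:E.
rewrite /= /gaussian_moment/= expr1.
have -> : 1`!%:R = 1 :> R by [].
have -> : 2`!%:R = 2 :> R by [].
by rewrite invr1; lra.
Qed.

End GaussianRV.

(** * Multinomial expansions *)

Section Multinomial.
Context {R : realType}.

(** Both sides are the coefficient of degree [N] in the product of the exponential polynomials
    [p j], truncated at degree [D]. Truncation does not affect degrees up to [D], and it places the
    exponents in a finite type. *)
Lemma multinomial (J : finType) (y : J -> R) N D : (N <= D)%N ->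
  (\sum_j y j) ^+ N / N`!%:R =
  \sum_(h : {ffun J -> 'I_D.+1} | (\sum_j h j == N)%N)
    \prod_j (y j ^+ h j / (h j)`!%:R).
Proof.
move=> ND; pose p j : {poly R} := \poly_(i < D.+1) (y j ^+ i / i`!%:R).
transitivity ((\prod_j p j)`_N).
  suff H (s : seq J) k : (k <= D)%N ->
      (\prod_(j <- s) p j)`_k = (\sum_(j <- s) y j) ^+ k / k`!%:R.
    by rewrite H.
  elim: s k => [|j s IH] k kN.
    by rewrite !big_nil coef1 expr0n; case: k kN => [|k] _; rewrite ?fact0 ?divr1 ?mul0r.
  rewrite !big_cons coefM addrC exprDn mulr_suml; apply: eq_bigr => i _.
  have ik : (i <= k)%N by rewrite -ltnS.
  rewrite coef_poly ltnS (leq_trans ik kN) IH ?(leq_trans (leq_subr _ _) kN)//.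
  rewrite -(bin_fact ik) -mulr_natr natrM natrM.
  by field; rewrite !pnatr_eq0 -!lt0n !fact_gt0 bin_gt0.
rewrite /p (eq_bigr (fun j => \sum_(i < D.+1) (y j ^+ i / i`!%:R) *: 'X^i)); last first.
  by move=> j _; rewrite poly_def.
rewrite bigA_distr_bigA coef_sum [RHS]big_mkcond; apply: eq_bigr => h _.
transitivity (((\prod_j (y j ^+ h j / (h j)`!%:R)) *: 'X^(\sum_j h j) : {poly R})`_N).
  congr (_ : {poly R})`_N.
  rewrite scaler_prod; congr (_ *: _).
  by rewrite expr_sum.
by rewrite coefZ coefXn eq_sym; case: ifP => _; rewrite ?mulr1 ?mulr0.
Qed.

Lemma poly_eqP (p q : {poly R}) : (forall x, p.[x] = q.[x]) -> p = q.
Proof.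
move=> pq; apply/eqP; rewrite -subr_eq0; apply/eqP.
apply: (@roots_geq_poly_eq0 _ _ [seq i%:R | i <- iota 0 (size (p - q))]).
- by apply/allP => x _; rewrite /root !hornerE pq subrr.
- by rewrite map_inj_uniq ?iota_uniq// => i j /eqP; rewrite eqr_nat => /eqP.
- by rewrite size_map size_iota.
Qed.

Lemma base_expansion_inj D n (a b : 'I_n -> 'I_D) :
  (\sum_(i < n) a i * D ^ i = \sum_(i < n) b i * D ^ i)%N -> a =1 b.
Proof.
elim: n a b => [|n IH] a b; first by move=> _ [].
rewrite !big_ord_recl expn0 !muln1.
have E (c : 'I_n.+1 -> 'I_D) :
    (\sum_(i < n) c (lift ord0 i) * D ^ (bump 0 i) =
     (\sum_(i < n) c (lift ord0 i) * D ^ i) * D)%N.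
  by rewrite big_distrl; apply: eq_bigr => i _; rewrite /bump add1n expnSr mulnA.
rewrite !E => ab.
have D0 : (0 < D)%N by case: (a ord0) => i; exact: leq_ltn_trans.
have a0 : a ord0 = b ord0.
  apply: val_inj; have := congr1 (modn^~ D) ab.
  by rewrite !(addnC (nat_of_ord _)) !modnMDl !modn_small.
move: ab; rewrite a0 => /addnI/eqP; rewrite eqn_pmul2r// => /eqP/IH ab i.
by case: (unliftP ord0 i) => [j|] ->; rewrite ?a0// ab.
Qed.

(* Kronecker substitution reduces the comparison to univariate polynomials. *)
Lemma monomial_coef_inj (J : finType) D (A B : {ffun J -> 'I_D} -> R) :
  (forall c : J -> R, \sum_b A b * \prod_j c j ^+ b j =
                      \sum_b B b * \prod_j c j ^+ b j) -> A =1 B.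
Proof.
move=> AB.
(* The exponents [b j < D] are the base-[D] digits of [k b], so substituting
   [x ^+ (D ^ enum_rank j)] for [c j] sends distinct monomials to distinct powers of [x]. *)
pose k (b : {ffun J -> 'I_D}) := (\sum_j b j * D ^ enum_rank j)%N.
have k_inj : injective k.
  move=> a b; rewrite /k !(reindex _ (onW_bij _ (@enum_val_bij J)))/= => ab.
  apply/ffunP => j; rewrite -(enum_rankK j).
  apply: (@base_expansion_inj D _ (a \o enum_val) (b \o enum_val)).
  by move: ab; under eq_bigr do rewrite enum_valK;
    under [in RHS]eq_bigr do rewrite enum_valK.
pose p (C : {ffun J -> 'I_D} -> R) : {poly R} := \sum_b C b *: 'X^(k b).
have coefp C b : (p C)`_(k b) = C b.
  rewrite coef_sum (bigD1 b)//= coefZ coefXn eqxx mulr1 big1 ?addr0// => a ab.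
  by rewrite coefZ coefXn (inj_eq k_inj) eq_sym (negbTE ab) mulr0.
move=> b; rewrite -coefp -[RHS]coefp; congr (_ : {poly R})`_ _.
apply: poly_eqP => x.
have H C : (p C).[x] = \sum_b C b * \prod_j (x ^+ (D ^ enum_rank j)) ^+ b j.
  rewrite horner_sum; apply: eq_bigr => a _; rewrite hornerZ hornerXn.
  congr (_ * _); rewrite /k expr_sum; apply: eq_bigr => j _.
  by rewrite mulnC exprM.
by rewrite !H AB.
Qed.

End Multinomial.

(** * Edges of multigraphs and Wick's formula *)

Section Edges.
Variable V : finType.
Implicit Types (E : edge V) (u v w : V).

Definition loop E := #|val E| == 1%N.

(* A loop at [v] counts twice. *)
Definition incidence E v : nat := ((v \in val E) + (val E == [set v]%SET))%N.

Lemma edgeP E : exists u v, E = pair_edge u v.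
Proof.
by case: E => E Ep; case/imsetP: (Ep) => -[u v] _ /= Euv; exists u, v; exact: val_inj.
Qed.

Lemma pair_edgeC u v : pair_edge u v = pair_edge v u.
Proof. by apply: val_inj; rewrite /= finset.setUC. Qed.

Lemma pair_edge_eq u v u' v' : (pair_edge u v == pair_edge u' v') =
  ((u, v) == (u', v')) || ((u, v) == (v', u')).
Proof.
apply/eqP/idP => [/(congr1 val)/=/finset.setP H|/orP[]/eqP[-> ->]//]; last exact: pair_edgeC.
rewrite !xpair_eqE.
have := H u; have := H v; have := H u'; have := H v'.
rewrite !inE !eqxx !orbT/= (eq_sym u' u) (eq_sym u' v) (eq_sym v' u) (eq_sym v' v).
by case: (u == u') (u == v') (v == u') (v == v') => [] [] [] [].
Qed.

Lemma loop_pair_edge u v : loop (pair_edge u v) = (u == v).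
Proof. by rewrite /loop /= cards2; case: (u == v). Qed.

Lemma incidence_pair_edge u v w :
  incidence (pair_edge u v) w = ((w == u) + (w == v))%N.
Proof.
rewrite /incidence /= !inE.
have -> : ([set u; v] == [set w])%SET = (w == u) && (w == v).
  apply/eqP/andP => [/finset.setP H|[/eqP<- /eqP<-]]; last by rewrite finset.setUid.
  have := H u; have := H v; rewrite !inE !eqxx ?orbT/=.
  by rewrite !(eq_sym w) => <- <-.
by case: (w == u) (w == v) => [] [].
Qed.

Lemma prod_incidence (R : comPzSemiRingType) (c : V -> R) u v :
  \prod_w c w ^+ incidence (pair_edge u v) w = c u * c v.
Proof.
under eq_bigr do rewrite incidence_pair_edge exprD.
have P1 t : \prod_w c w ^+ (w == t) = c t.
  by rewrite (bigD1 t)//= eqxx expr1 big1 ?mulr1// => w /negbTE ->; rewrite expr0.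
by rewrite big_split/= !P1.
Qed.

Lemma sum_incidence E : (\sum_v incidence E v = 2)%N.
Proof.
have [u [v ->]] := edgeP E; under eq_bigr do rewrite incidence_pair_edge.
by rewrite big_split/= -!big_mkcond/= !big_pred1_eq.
Qed.

Lemma big_loops (T : Type) (idx : T) (op : Monoid.com_law idx) (F : edge V -> T) :
  \big[op/idx]_(E | loop E) F E = \big[op/idx]_v F (pair_edge v v).
Proof.
have inj : {in [set: V]%SET &, injective (fun v => pair_edge v v)}.
  by move=> u v _ _ /eqP; rewrite pair_edge_eq orbb xpair_eqE andbb => /eqP.
transitivity (\big[op/idx]_(v in [set: V]%SET) F (pair_edge v v)); last first.
  by apply: eq_bigl => v; rewrite inE.
rewrite -(big_imset _ inj); apply: eq_bigl => E.
apply/idP/imsetP => [|[v _ ->]]; last by rewrite loop_pair_edge.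
by have [u [v ->]] := edgeP E; rewrite loop_pair_edge => /eqP ->; exists v.
Qed.

Lemma big_incident (T : Type) (idx : T) (op : Monoid.com_law idx) (F : edge V -> T) v :
  \big[op/idx]_(E : edge V | v \in val E) F E = \big[op/idx]_w F (pair_edge v w).
Proof.
have inj : {in [set: V]%SET &, injective (pair_edge v)}.
  move=> u w _ _ /eqP; rewrite pair_edge_eq !xpair_eqE eqxx/=.
  by case/orP => [/eqP//|/andP[/eqP-> /eqP->]].
transitivity (\big[op/idx]_(w in [set: V]%SET) F (pair_edge v w)); last first.
  by apply: eq_bigl => w; rewrite inE.
rewrite -(big_imset _ inj); apply: eq_bigl => E.
apply/idP/imsetP => [|[w _ ->]]; last by rewrite !inE eqxx.
have [u [w ->]] := edgeP E; rewrite !inE => /orP[] /eqP ->; first by exists w.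
by exists u => //; exact: pair_edgeC.
Qed.

Lemma degree_incidence (G : multigraph V) v :
  degree G v = (\sum_E incidence E v * G E)%N.
Proof.
rewrite /degree /incidence; under [RHS]eq_bigr do rewrite mulnDl.
rewrite big_split/= mul2n -addnn -addnA addnC; congr (_ + _)%N.
  rewrite addnC; under [RHS]eq_bigr do rewrite mulnbl.
  by rewrite -big_mkcond big_incident [RHS](bigD1 v)//= addnC.
rewrite (bigD1 (pair_edge v v))//= finset.setUid eqxx mul1n big1 ?addn0// => E NE.
case: eqP => [Ev|//]; case/eqP: NE; apply: val_inj; rewrite /= Ev.
by rewrite finset.setUid.
Qed.

(** Every edge has exactly one presentation by vertices of nondecreasing rank. This turns the index
    products of [symmetry_factor] and [integral_along] into products over edges. *)
Lemma ordered_pairs_edges (T : Type) (idx : T) (op : Monoid.com_law idx) (F : edge V -> T) :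
  \big[op/idx]_(a < #|V|) \big[op/idx]_(b < #|V| | (a <= b)%N)
    F (pair_edge (enum_val a) (enum_val b)) = \big[op/idx]_E F E.
Proof.
rewrite pair_big_dep/=.
rewrite (partition_big (fun p : 'I_#|V| * 'I_#|V| =>
  pair_edge (enum_val p.1) (enum_val p.2)) xpredT)//=.
apply: eq_bigr => E _.
have [u [v [Euv uv]]] : exists u v, E = pair_edge u v /\ (enum_rank u <= enum_rank v)%N.
  have [u [v ->]] := edgeP E.
  have [uv|vu] := leqP (enum_rank u) (enum_rank v); first by exists u, v.
  by exists v, u; split; [exact: pair_edgeC|exact: ltnW].
rewrite (big_pred1 (enum_rank u, enum_rank v)) /= ?enum_rankK ?Euv// => -[a b] /=.
rewrite pair_edge_eq -{1 2 3}(enum_rankK u) -{1 2 3}(enum_rankK v) !xpair_eqE.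
rewrite !(inj_eq enum_val_inj) !enum_rankK.
apply/idP/idP => [/andP[ab /orP[//|/andP[/eqP av /eqP bu]]]|/andP[/eqP-> /eqP->]].
  have uvE : enum_rank u = enum_rank v.
    by apply/val_inj/eqP; rewrite eqn_leq uv/= -av -bu.
  by rewrite av bu uvE eqxx.
by rewrite uv !eqxx.
Qed.

Lemma sum_pair_edge (R : pzSemiRingType) (F : edge V -> R) :
  \sum_u \sum_v F (pair_edge u v) = \sum_E F E *+ (if loop E then 1 else 2)%N.
Proof.
rewrite pair_big/= (partition_big (fun p : V * V => pair_edge p.1 p.2) xpredT)//=.
apply: eq_bigr => E _; rewrite (eq_bigr (fun=> F E)); last by move=> p /eqP ->.
rewrite sumr_const; congr (_ *+ _).
have [u [v ->]] := edgeP E; rewrite loop_pair_edge.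
transitivity #|[set (u, v); (v, u)]%SET|.
  by apply: eq_card => -[a b]; rewrite in_set2 -pair_edge_eq unfold_in.
by rewrite cards2 xpair_eqE (eq_sym v u) andbb; case: eqP.
Qed.

End Edges.

Section Wick.
Context {R : realType}.

(* In the quadratic form [\sum_(u, v) c u * c v * g {u, v}] an edge occurs
   twice and a loop once; the weight is half the number of occurrences. *)
Definition edge_weight (V : finType) (E : edge V) : R := if loop E then 2^-1 else 1.

(** The power of 2 in the denominator is the product of the weights [2^-1] of the loops, taken with
    multiplicity. *)
Lemma symmetry_factorE (V : finType) (G : multigraph V) :
  symmetry_factor R G = (\prod_v (degree G v)`!)%N%:R *
    \prod_E (edge_weight E ^+ G E / (G E)`!%:R).
Proof.
rewrite /symmetry_factor (ordered_pairs_edges _ (fun E => (G E)`!)).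
congr (_ * _); rewrite natrM invfM big_split/= natr_prod -prodfV; congr (_ * _).
rewrite natrX -exprVn [RHS](bigID (@loop V))/= [X in _ * X]big1; last first.
  by move=> E /negbTE nE; rewrite /edge_weight nE expr1n.
rewrite mulr1 big_loops expr_sum; apply: eq_bigr => v _.
by rewrite /edge_weight loop_pair_edge eqxx.
Qed.

Variables (Q V : finType).

(** [M a] stands for the mixed moment with exponents [a]. The hypothesis is the [N]-th moment of the
    linear form with coefficients [c], divided by the factorial of [N] and expanded on the left; the
    conclusion is the equality of the coefficients of one monomial in [c]. *)
Lemma wick_coefficients N (g : edge V -> R)
    (M : {ffun Q * V -> 'I_N.+1} -> R) (b : {ffun Q * V -> 'I_N.+1}) :
  (forall c : Q * V -> R,
    \sum_(a : {ffun Q * V -> 'I_N.+1} | (\sum_j a j == N)%N)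
      M a * \prod_j (c j ^+ a j / (a j)`!%:R) =
    gaussian_moment N
      (\sum_q \sum_u \sum_v c (q, u) * c (q, v) * g (pair_edge u v))) ->
  (\sum_j b j = N)%N ->
  M b / (\prod_j (b j)`!)%N%:R =
  \sum_(h : {ffun Q * edge V -> 'I_N.+1} |
      [forall j, \sum_E incidence E j.2 * h (j.1, E) == b j]%N)
    \prod_j ((edge_weight j.2 * g j.2) ^+ h j / (h j)`!%:R).
Proof.
move=> HM bN.
pose deg (h : {ffun Q * edge V -> 'I_N.+1}) j := (\sum_E incidence E j.2 * h (j.1, E))%N.
pose C (h : {ffun Q * edge V -> 'I_N.+1}) :=
  \prod_j ((edge_weight j.2 * g j.2) ^+ h j / (h j)`!%:R).
(* The handshake identity: every edge has total incidence 2. *)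
have sum_deg (h : {ffun Q * edge V -> 'I_N.+1}) : (\sum_j deg h j = (\sum_j h j).*2)%N.
  rewrite /deg -(pair_bigA _ (fun q v => \sum_E incidence E v * h (q, E)))%N/=.
  rewrite [in RHS](eq_bigr (fun j => h (j.1, j.2) : nat)); last by case.
  rewrite -[in RHS](pair_bigA _ (fun q E => h (q, E) : nat))/=.
  rewrite -mul2n big_distrr/=; apply: eq_bigr => q _.
  rewrite exchange_big big_distrr; apply: eq_bigr => E _ /=.
  by rewrite -big_distrl/= sum_incidence.
(* [A] and [B] are the coefficients of the two sides. When the [b j] sum to [N], prescribing the
   degrees already fixes the number of edges to [N./2] and excludes odd [N], so the extra conditions
   in [B] disappear. *)
pose A (b : {ffun Q * V -> 'I_N.+1}) := if (\sum_j b j == N)%N 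
  then M b / (\prod_j (b j)`!)%N%:R else 0.
pose B (b : {ffun Q * V -> 'I_N.+1}) := if odd N then 0 else
  \sum_(h : {ffun Q * edge V -> 'I_N.+1} |
    (\sum_j h j == N./2)%N && [forall j, deg h j == b j]) C h.
suff AB : A =1 B.
  have := AB b; rewrite /A bN eqxx /B => ->; case: ifPn => [oN|eN].
    rewrite big1// => h /forallP hb.
    suff : ~~ odd N by rewrite oN.
    rewrite -bN (eq_bigr (deg h)); last by move=> j _; exact/esym/eqP/hb.
    by rewrite sum_deg odd_double.
  apply: eq_bigl => h; case: forallP => [hb|]; rewrite ?andbF// andbT.
  rewrite -(inj_eq double_inj) -sum_deg even_halfK//.
  rewrite (eq_bigr (fun j => b j : nat)); last by move=> j _; exact/eqP.
  by rewrite bN eqxx.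
apply: monomial_coef_inj => c.
transitivity (gaussian_moment N
    (\sum_q \sum_u \sum_v c (q, u) * c (q, v) * g (pair_edge u v))).
  rewrite -HM [RHS]big_mkcond; apply: eq_bigr => a _; rewrite /A.
  case: ifP => _; last by rewrite mul0r.
  by rewrite big_split/= prodfV natr_prod mulrA mulrAC -mulrA.
rewrite /gaussian_moment /B; case: ifPn => oN.
  by rewrite big1// => a _; rewrite mul0r.
pose y (j : Q * edge V) : R :=
  edge_weight j.2 * g j.2 * \prod_v c (j.1, v) ^+ incidence j.2 v.
have -> : (\sum_q \sum_u \sum_v c (q, u) * c (q, v) * g (pair_edge u v)) / 2 =
    \sum_j y j.
  rewrite [RHS](eq_bigr (fun j => y (j.1, j.2))); last by case.
  rewrite mulr_suml -(pair_bigA _ (fun q E => y (q, E)))/=; apply: eq_bigr => q _.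
  pose F E := g E * \prod_v c (q, v) ^+ incidence E v.
  under eq_bigr do under eq_bigr do
    rewrite -(prod_incidence (fun v => c (q, v))) mulrC -/(F _).
  rewrite sum_pair_edge mulr_suml; apply: eq_bigr => E _.
  rewrite /y /edge_weight /= -mulrA -/(F E); case: ifP => _.
    by rewrite mulr1n mulrC.
  by rewrite -(mulr_natr (F E)) mulfK// mul1r.
rewrite (@multinomial _ _ y _ N); last by rewrite -{2}(half_double N) half_leq -?addnn ?leq_addr.
have deg_le (h : {ffun Q * edge V -> 'I_N.+1}) j : (\sum_j h j == N./2)%N ->
    (deg h j <= N)%N.
  move=> /eqP hN; apply: leq_trans (_ : \sum_j deg h j <= N)%N.
    by rewrite (bigD1 j)//= leq_addr.
  by rewrite sum_deg hN even_halfK.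
(* With [N./2] edges all degrees are at most [N], so [inord] is exact on the terms that occur;
   grouping them by degrees collects the monomials in [c]. *)
pose degb (h : {ffun Q * edge V -> 'I_N.+1}) : {ffun Q * V -> 'I_N.+1} :=
  [ffun j => inord (deg h j)].
rewrite (partition_big degb xpredT)//=; apply: eq_bigr => a _.
rewrite mulr_suml; apply: eq_big => [h|h /andP[hN /eqP ha]].
  case hN: (_ == _) => //=; apply/eqP/forallP => [<- j|ha].
    by rewrite ffunE inordK// ltnS deg_le.
  by apply/ffunP => j; apply/val_inj; rewrite ffunE /= (eqP (ha j)) inord_val.
have {ha} -> : \prod_j c j ^+ a j = \prod_j c j ^+ deg h j.
  by apply: eq_bigr => j _; rewrite -ha ffunE inordK// ltnS deg_le.
have -> : \prod_j c j ^+ deg h j =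
    \prod_(j : Q * edge V) (\prod_v c (j.1, v) ^+ incidence j.2 v) ^+ h j.
  rewrite [LHS](eq_bigr (fun j => c (j.1, j.2) ^+ deg h (j.1, j.2))); last by case.
  rewrite -(pair_bigA _ (fun q v => c (q, v) ^+ deg h (q, v)))/=.
  rewrite [RHS](eq_bigr (fun j => (\prod_v c (j.1, v) ^+ incidence j.2 v) ^+
    h (j.1, j.2))); last by case.
  rewrite -[RHS](pair_bigA _ (fun q E =>
    (\prod_v c (q, v) ^+ incidence E v) ^+ h (q, E)))/=.
  apply: eq_bigr => q _; under [RHS]eq_bigr do rewrite -prodrXl.
  rewrite exchange_big; apply: eq_bigr => v _; rewrite expr_sum/=.
  by apply: eq_bigr => E _; rewrite exprM.
rewrite -big_split; apply: eq_bigr => j _.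
by rewrite /y exprMn mulrAC.
Qed.

End Wick.

Section AllMoments.
Context {R : realType} d (T : measurableType d) (P : probability T R).

(* Membership in every L^p, a class closed under products. *)
Definition all_moments (W : T -> R) :=
  measurable_fun setT W /\ forall N, P.-integrable setT (fun w => (W w ^+ N)%:E).

Lemma all_moments_cst r : all_moments (cst r).
Proof.
split=> // N; exact: (finite_measure_integrable_cst P (r ^+ N)).
Qed.

(** A product is dominated by the sum of the squares of its factors, here applied to [N]-th
    powers. *)
Lemma all_momentsM W1 W2 : all_moments W1 -> all_moments W2 ->
  all_moments (fun w => W1 w * W2 w).
Proof.
move=> [m1 i1] [m2 i2]; split=> [|N]; first exact: measurable_funM.
apply: (@le_integrable _ _ _ _ _ _ _
  (fun w => (W1 w ^+ (N * 2))%:E + (W2 w ^+ (N * 2))%:E)%E) => //.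
- by apply/measurable_EFinP; apply: measurable_funX; exact: measurable_funM.
- move=> w _; rewrite /= lee_fin exprMn !exprM normrM.
  rewrite [leRHS]ger0_norm ?addr_ge0 ?sqr_ge0//.
  rewrite -(real_normK (num_real (W1 w ^+ N))) -(real_normK (num_real (W2 w ^+ N))).
  have := normr_ge0 (W1 w ^+ N); have := normr_ge0 (W2 w ^+ N).
  have := sqr_ge0 (`|W1 w ^+ N| - `|W2 w ^+ N|).
  by nra.
- exact: integrableD.
Qed.

Lemma all_momentsX W k : all_moments W -> all_moments (fun w => W w ^+ k).
Proof.
move=> [mW iW]; split=> [|N]; first exact: measurable_funX.
by under eq_fun do rewrite -exprM; exact: iW.
Qed.

Lemma all_moments_prod (I : Type) (s : seq I) (W : I -> T -> R) :
  (forall i, all_moments (W i)) -> all_moments (fun w => \prod_(i <- s) W i w).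
Proof.
move=> HW; elim: s => [|i s IH].
  by under eq_fun do rewrite big_nil; exact: all_moments_cst.
by under eq_fun do rewrite big_cons; exact: all_momentsM.
Qed.

Lemma all_moments_integrable W : all_moments W -> P.-integrable setT (EFin \o W).
Proof. by move=> [_ /(_ 1%N)]. Qed.

Variables (Q V : finType) (Z : Q * V -> T -> R) (g : edge V -> R).
Hypothesis mZ : forall j, measurable_fun setT (Z j).
Hypothesis gZ : forall c : Q * V -> R, gaussian_rv P (fun w => \sum_j c j * Z j w).
Hypothesis Z0 : forall j, (\int[P]_w (Z j w)%:E = 0)%E.
Hypothesis covZ : forall q r u v, (\int[P]_w (Z (q, u) w * Z (r, v) w)%:E =
  (g (pair_edge u v) * (q == r)%:R)%:E)%E.

Lemma all_moments_gaussian j : all_moments (Z j).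
Proof.
split=> // N; apply: gaussian_rv_integrable => //.
have := gZ (fun i => (i == j)%:R); congr (gaussian_rv P _).
apply/funext => w; rewrite (bigD1 j)//= eqxx mul1r big1 ?addr0// => i /negbTE ->.
by rewrite mul0r.
Qed.

Lemma all_moments_monomial (b : Q * V -> nat) :
  all_moments (fun w => \prod_j Z j w ^+ b j).
Proof.
by apply: all_moments_prod => j; apply: all_momentsX; exact: all_moments_gaussian.
Qed.

Lemma wick (N : nat) (b : {ffun Q * V -> 'I_N.+1}) : (\sum_j b j = N)%N ->
  (\int[P]_w (\prod_j Z j w ^+ b j)%:E = ((\prod_j (b j)`!)%N%:R *
  \sum_(h : {ffun Q * edge V -> 'I_N.+1} |
      [forall j, \sum_E incidence E j.2 * h (j.1, E) == b j]%N)
    \prod_j ((edge_weight j.2 * g j.2) ^+ h j / (h j)`!%:R))%:E)%E.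
Proof.
move=> bN.
pose M (a : {ffun Q * V -> 'I_N.+1}) := fine (\int[P]_w (\prod_j Z j w ^+ a j)%:E).
have ME (a : {ffun Q * V -> 'I_N.+1}) : (\int[P]_w (\prod_j Z j w ^+ a j)%:E = (M a)%:E)%E.
  by rewrite fineK//; apply: integrable_fin_num => //;
    apply/all_moments_integrable/all_moments_monomial.
rewrite -(@wick_coefficients _ _ _ _ g M)//.
  rewrite ME mulrC divfK// pnatr_eq0 -lt0n prodn_gt0// => j; exact: fact_gt0.
(* What remains is the hypothesis of [wick_coefficients]: the moment formula for the Gaussian
   variable [Y], once its mean and variance are known. *)
move=> c; pose Y w := \sum_j c j * Z j w.
have mY : measurable_fun setT Y.
  by apply: measurable_sum => j; exact: measurable_funM.
have iZ j : P.-integrable setT (fun w => (Z j w)%:E).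
  exact/all_moments_integrable/all_moments_gaussian.
have iZZ i j : P.-integrable setT (fun w => (Z i w * Z j w)%:E).
  by apply: all_moments_integrable; apply: all_momentsM; exact: all_moments_gaussian.
have Y0 : (\int[P]_w (Y w)%:E = 0)%E.
  under eq_integral do (rewrite -sumEFin; under eq_bigr do rewrite EFinM).
  rewrite integral_sum//; last by move=> j; exact: integrableZl.
  by rewrite big1// => j _; rewrite integralZl//= Z0 mule0.
have Y2 : (\int[P]_w (Y w ^+ 2)%:E =
    (\sum_q \sum_u \sum_v c (q, u) * c (q, v) * g (pair_edge u v))%:E)%E.
  transitivity (\int[P]_w (\sum_i \sum_j (c i * c j)%:E * (Z i w * Z j w)%:E))%E.
    apply: eq_integral => w _; rewrite expr2 /Y mulr_suml -sumEFin.
    apply: eq_bigr => i _; rewrite mulr_sumr -sumEFin; apply: eq_bigr => j _.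
    by rewrite -EFinM mulrACA.
  rewrite integral_sum//; last first.
    by move=> i; apply: integrable_sum => // j _; exact: integrableZl.
  rewrite (eq_bigr (fun i => (\sum_v c i * c (i.1, v) * g (pair_edge i.2 v))%:E)).
    rewrite sumEFin; congr EFin; rewrite [RHS]pair_bigA.
    by apply: eq_bigr => -[].
  move=> [q u] _; rewrite integral_sum//; last by move=> j; exact: integrableZl.
  under eq_bigr do rewrite integralZl//.
  rewrite (eq_bigr (fun j => (c (q, u) * c (j.1, j.2) *
    (g (pair_edge u j.2) * (q == j.1)%:R))%:E)); last first.
    by move=> [r v] _; rewrite covZ.
  rewrite sumEFin -(pair_bigA _ (fun r v =>
    c (q, u) * c (r, v) * (g (pair_edge u v) * (q == r)%:R)))/=.
  (* Different components are uncorrelated, so only pairs of vertices with the same [q] survive;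
     this is why each [q] gets its own multigraph. *)
  rewrite (bigD1 q)//= [X in _ + X]big1 ?addr0; last first.
    move=> r; rewrite eq_sym => /negbTE rq.
    by rewrite big1// => v _; rewrite rq !mulr0.
  by congr EFin; apply: eq_bigr => v _; rewrite eqxx mulr1.
have := gaussian_rv_moment mY (gZ c) N Y0; rewrite Y2 /= => YN.
apply: (@mulfI _ N`!%:R); first by rewrite pnatr_eq0 -lt0n fact_gt0.
apply: EFin_inj; rewrite -YN.
transitivity (\int[P]_w (\sum_(a : {ffun Q * V -> 'I_N.+1} | (\sum_j a j == N)%N)
    (N`!%:R * \prod_j (c j ^+ a j / (a j)`!%:R))%:E * (\prod_j Z j w ^+ a j)%:E))%E.
  rewrite integral_sum//; last first.
    move=> a; apply: integrableZl => //.
    exact/all_moments_integrable/all_moments_monomial.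
  rewrite mulr_sumr -sumEFin; apply: eq_bigr => a _.
  rewrite integralZl//; last exact/all_moments_integrable/all_moments_monomial.
  by rewrite ME -EFinM; congr EFin; rewrite mulrA mulrAC.
apply: eq_integral => w _; rewrite sumEFin; congr EFin.
have fN : N`!%:R != 0 :> R by rewrite pnatr_eq0 -lt0n fact_gt0.
rewrite -[RHS](divfK fN) (@multinomial _ _ _ N N)// mulr_suml.
apply: eq_bigr => a _; rewrite mulrC mulrCA mulrC; congr (_ * _).
rewrite -big_split; apply: eq_bigr => j _.
by rewrite exprMn /= mulrA [Z j w ^+ _ * _]mulrC.
Qed.

End AllMoments.

(** * Iterated integrals over the cube *)

Section IteratedIntegral.
Context {R : realType} (V : eqType).
Local Notation RT := (measurableTypeR R).
Local Notation U01 := (uniform_prob (@ltr01 R)).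
Implicit Types (x : V -> R) (r : seq V) (F G : (V -> R) -> R).

Definition upd x v (y : R) : V -> R := fun u => if u == v then y else x u.

(* Bounded, and measurable along every measurable family of points; this is
   joint measurability without a sigma-algebra on [V -> R]. *)
Definition nice F :=
  (exists M, forall x, `|F x| <= M) /\
  forall d (T : measurableType d) (g : V -> T -> RT),
    (forall v, measurable_fun setT (g v)) ->
    measurable_fun setT (fun t => F (g^~ t) : RT).

(* Integrating one named coordinate at a time reduces permuting and splitting
   the variables to a two-variable Fubini swap. *)
Fixpoint iter_int r F x : R :=
  if r is v :: r' then \int[U01]_y iter_int r' F (upd x v y) else F x.

Lemma measurable_upd d (T : measurableType d) (g : V -> T -> RT) v u :
  (forall v, measurable_fun setT (g v)) ->
  measurable_fun setT (fun p : T * RT => upd (g^~ p.1) v p.2 u : RT).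
Proof.
move=> mg; rewrite /upd; case: eqP => _; first exact: measurable_snd.
exact: measurableT_comp.
Qed.

Lemma bounded_integrable d (T : measurableType d) (P : probability T R)
    (h : T -> R) M :
  measurable_fun setT h -> (forall t, `|h t| <= M) ->
  P.-integrable setT (fun t => (h t)%:E).
Proof.
move=> mh hM; apply: measurable_bounded_integrable => //.
  by rewrite (le_lt_trans (probability_le1 P measurableT)) ?ltry.
exists M; split; first exact: num_real.
by move=> K MK t _; exact: le_trans (hM t) (ltW MK).
Qed.

Lemma bounded_integrable2 d1 d2 (T1 : measurableType d1) (T2 : measurableType d2)
    (P1 : probability T1 R) (P2 : probability T2 R) (h : T1 * T2 -> R) M :
  measurable_fun setT h -> (forall t, `|h t| <= M) ->
  (P1 \x P2)%E.-integrable setT (fun t => (h t)%:E).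
Proof.
move=> mh hM; apply: measurable_bounded_integrable => //.
  rewrite -setXTT [ltLHS]product_measure1E//=.
  rewrite !probability_setT mule1; exact: ltry.
exists M; split; first exact: num_real.
by move=> K MK t _; exact: le_trans (hM t) (ltW MK).
Qed.

Lemma nice_upd_integrable F x v : nice F ->
  U01.-integrable setT (fun y => (F (upd x v y))%:E).
Proof.
move=> [[M FM] mF]; apply: (@bounded_integrable _ _ _ _ M) => [|y //].
apply: (mF _ RT (fun u y => upd x v y u)) => u; rewrite /upd.
by case: eqP.
Qed.

Lemma nice_int F v : nice F -> nice (fun x => \int[U01]_y F (upd x v y)).
Proof.
move=> nF; have [[M FM] mF] := nF; split.
  exists M => x; rewrite (le_trans (le_normr_Rintegral _ (nice_upd_integrable x v nF)))//.
  rewrite -[leRHS](_ : \int[U01]_y (cst M y) = M); last first.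
    by rewrite Rintegral_cst//= probability_setT mulr1.
  apply: le_Rintegral => //.
  - by apply: integrable_norm; exact: nice_upd_integrable.
  - exact: finite_measure_integrable_cst.
move=> d T g mg.
pose h (p : T * RT) := (F (upd (g^~ p.1) v p.2))%:E.
have mh : measurable_fun setT h.
  apply/measurable_EFinP; apply: (mF _ _ (fun u p => upd (g^~ p.1) v p.2 u)) => u.
  exact: measurable_upd.
(* Measurability of a parametric integral is obtained from Fubini, which asks for a measure on the
   parameter space; a Dirac mass is available on any [T]. *)
have ih : (\d_(point : T) \x U01)%E.-integrable setT h.
  by apply: (@bounded_integrable2 _ _ _ _ _ _ _ M) => //; exact/measurable_EFinP.
apply: measurableT_comp => //; exact: measurable_fubini_F ih.
Qed.

Lemma nice_iter_int r F : nice F -> nice (iter_int r F).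
Proof. by move=> nF; elim: r => //= v r IH; exact: nice_int. Qed.

Lemma nice_cst c : nice (fun=> c).
Proof. by split=> [|d T g mg]; [exists `|c| | exact: measurable_cst]. Qed.

Lemma niceD F G : nice F -> nice G -> nice (fun x => F x + G x).
Proof.
move=> [[M FM] mF] [[N GN] mG]; split=> [|d T g mg].
  by exists (M + N) => x; rewrite (le_trans (ler_normD _ _))// lerD.
by apply: measurable_funD; [exact: mF|exact: mG].
Qed.

Lemma niceM F G : nice F -> nice G -> nice (fun x => F x * G x).
Proof.
move=> [[M FM] mF] [[N GN] mG]; split=> [|d T g mg].
  by exists (M * N) => x; rewrite normrM ler_pM.
by apply: measurable_funM; [exact: mF|exact: mG].
Qed.

Lemma nice_sum (I : Type) (s : seq I) (P : pred I) (F : I -> (V -> R) -> R) :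
  (forall i, nice (F i)) -> nice (fun x => \sum_(i <- s | P i) F i x).
Proof.
move=> nF; elim: s => [|i s IH].
  by under eq_fun do rewrite big_nil; exact: nice_cst.
under eq_fun do rewrite big_cons.
by case: (P i) => //; exact: niceD.
Qed.

Lemma nice_prod (I : Type) (s : seq I) (P : pred I) (F : I -> (V -> R) -> R) :
  (forall i, nice (F i)) -> nice (fun x => \prod_(i <- s | P i) F i x).
Proof.
move=> nF; elim: s => [|i s IH].
  by under eq_fun do rewrite big_nil; exact: nice_cst.
under eq_fun do rewrite big_cons.
by case: (P i) => //; exact: niceM.
Qed.

Lemma niceX F k : nice F -> nice (fun x => F x ^+ k).
Proof.
move=> nF; elim: k => [|k IH]; first exact: nice_cst.
by under eq_fun do rewrite exprS; exact: niceM.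
Qed.

Lemma iter_intD r F G x : nice F -> nice G ->
  iter_int r (fun x => F x + G x) x = iter_int r F x + iter_int r G x.
Proof.
move=> nF nG; elim: r x => //= v r IH x; under eq_Rintegral do rewrite IH.
by rewrite RintegralD//; apply: nice_upd_integrable; exact: nice_iter_int.
Qed.

Lemma iter_intZ r F c x : nice F ->
  iter_int r (fun x => c * F x) x = c * iter_int r F x.
Proof.
move=> nF; elim: r x => //= v r IH x; under eq_Rintegral do rewrite IH.
by rewrite RintegralZl//; apply: nice_upd_integrable; exact: nice_iter_int.
Qed.

Lemma iter_int_cst r c x : iter_int r (fun=> c) x = c.
Proof.
elim: r x => //= v r IH x; under eq_Rintegral do rewrite IH.
by rewrite Rintegral_cst//= probability_setT mulr1.
Qed.

Lemma iter_int_sum (I : Type) (s : seq I) (P : pred I) (F : I -> (V -> R) -> R) r x :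
  (forall i, nice (F i)) ->
  iter_int r (fun x => \sum_(i <- s | P i) F i x) x =
  \sum_(i <- s | P i) iter_int r (F i) x.
Proof.
move=> nF; elim: s => [|i s IH].
  by rewrite big_nil; under eq_fun do rewrite big_nil; exact: iter_int_cst.
under eq_fun do rewrite big_cons; rewrite big_cons.
case: (P i) => //; rewrite iter_intD ?IH//; exact: nice_sum.
Qed.

Lemma iter_int_le r F G x : nice F -> nice G -> (forall x, F x <= G x) ->
  iter_int r F x <= iter_int r G x.
Proof.
move=> nF nG FG; elim: r x => //= v r IH x.
by apply: le_Rintegral => //; apply: nice_upd_integrable; exact: nice_iter_int.
Qed.

Lemma iter_int_cat r1 r2 F x :
  iter_int (r1 ++ r2) F x = iter_int r1 (iter_int r2 F) x.
Proof. by elim: r1 x => //= v r IH x; apply: eq_Rintegral => y _. Qed.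

Lemma upd_comm x u v y z : u != v -> upd (upd x u y) v z = upd (upd x v z) u y.
Proof.
move=> uv; apply/funext => w; rewrite /upd.
by case: (eqVneq w v) => // ->; rewrite eq_sym (negbTE uv).
Qed.

Lemma iter_int_swap u v r F x : nice F ->
  iter_int [:: u, v & r] F x = iter_int [:: v, u & r] F x.
Proof.
move=> nF; have [->//|uv] := eqVneq u v; rewrite /=.
have nK := nice_iter_int r nF; set K := iter_int r F in nK *.
pose h (p : RT * RT) := (K (upd (upd x u p.1) v p.2))%:E.
have ih : (U01 \x U01)%E.-integrable setT h.
  have [[M KM] mK] := nK.
  apply: (@bounded_integrable2 _ _ _ _ _ _ _ M) => //.
  apply: (mK _ _ (fun w p => upd (upd x u p.1) v p.2 w)) => w.
  apply: (@measurable_upd _ _ (fun w y => upd x u y w)) => {}w.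
  by rewrite /upd; case: eqP.
rewrite /Rintegral; congr fine.
transitivity (\int[U01]_y \int[U01]_z h (y, z))%E.
  apply: eq_integral => y _; rewrite fineK//.
  by apply: integrable_fin_num => //; exact: nice_upd_integrable.
rewrite (Fubini ih); apply: eq_integral => z _; rewrite fineK.
  by apply: eq_integral => y _; rewrite /h/= upd_comm.
by apply: integrable_fin_num => //; exact: nice_upd_integrable.
Qed.

Lemma iter_int_perm r1 r2 F x : nice F -> perm_eq r1 r2 ->
  iter_int r1 F x = iter_int r2 F x.
Proof.
move=> nF; have mid v s1 s2 y : iter_int (s1 ++ v :: s2) F y =
    iter_int (v :: s1 ++ s2) F y.
  elim: s1 y => // w s1 IH y; rewrite cat_cons iter_int_swap//.
  by apply: eq_Rintegral => z _; exact: IH.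
elim: r1 r2 x => [|v r1 IH] r2 x; first by rewrite perm_sym => /perm_nilP ->.
move=> p; have vr2 : v \in r2 by rewrite -(perm_mem p) mem_head.
case/splitPr: vr2 p => s1 s2 p; rewrite mid.
apply: eq_Rintegral => y _; apply: IH; rewrite -(perm_cons v).
by rewrite (perm_trans p)// -cat1s perm_catCA.
Qed.

Definition depends_on (B : pred V) F :=
  forall x y, (forall v, B v -> x v = y v) -> F x = F y.

Lemma depends_on_iter_int B r F : depends_on B F -> depends_on B (iter_int r F).
Proof.
move=> BF; elim: r => //= v r IH x y xy.
apply: eq_Rintegral => z _; apply: IH => w Bw; rewrite /upd.
by case: eqP => // _; exact: xy.
Qed.

(** Each integration moves a coordinate on which one factor does not depend, so that factor comes
    out as a constant. It serves to split off one component from the remaining ones. *)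
Lemma iter_int_prod r1 r2 (B C : pred V) F G x : nice F -> nice G ->
  depends_on B F -> depends_on C G ->
  (forall v, v \in r1 -> ~~ C v) -> (forall v, v \in r2 -> ~~ B v) ->
  iter_int (r1 ++ r2) (fun x => F x * G x) x = iter_int r1 F x * iter_int r2 G x.
Proof.
move=> nF nG BF CG Cr1 Br2; elim: r1 x Cr1 => [|v r1 IH] x Cr1 /=.
  elim: r2 x Br2 => //= v r2 IH x Br2.
  rewrite -RintegralZl//; last by apply: nice_upd_integrable; exact: nice_iter_int.
  apply: eq_Rintegral => y _; rewrite IH; last first.
    by move=> w wr; apply: Br2; rewrite in_cons wr orbT.
  congr (_ * _); apply: BF => w Bw; rewrite /upd; case: eqP => // wv.
  by have := Br2 v (mem_head _ _); rewrite -wv Bw.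
rewrite -RintegralZr//; last by apply: nice_upd_integrable; exact: nice_iter_int.
apply: eq_Rintegral => y _; rewrite IH; last first.
  by move=> w wr; apply: Cr1; rewrite in_cons wr orbT.
congr (_ * _); apply: (@depends_on_iter_int C r2 G CG) => w Cw; rewrite /upd.
by case: eqP => // wv; have := Cr1 v (mem_head _ _); rewrite -wv Cw.
Qed.

Lemma iter_int_map (p q : V -> V) r F x : cancel p q -> cancel q p ->
  iter_int (map p r) F x = iter_int r (fun y => F (y \o q)) (x \o p).
Proof.
move=> pK qK; elim: r x => [|v r IH] x /=.
  by congr F; apply/funext => w /=; rewrite qK.
apply: eq_Rintegral => y _; rewrite IH; congr (iter_int r _ _).
by apply/funext => w; rewrite /upd /= (can_eq pK).
Qed.

Lemma nice_tie u v : nice (fun x => (x u == x v)%:R).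
Proof.
split=> [|d T g mg].
  by exists 1 => x; case: eqP => _; rewrite ?normr1 ?normr0.
pose i (b : bool) : RT := b%:R.
apply: (@measurableT_comp _ _ _ _ _ _ i) => //.
exact: (@measurable_fun_eqr _ _ R _ (g u) (g v) (mg u) (mg v)).
Qed.

(** With [u] moved to the innermost place, its integral is the uniform mass of the single point
    given by the coordinate [v], which is zero. *)
Lemma iter_int_tie r u v x : u \in r -> u != v ->
  iter_int r (fun x => (x u == x v)%:R) x = 0.
Proof.
move=> ur uv; rewrite (@iter_int_perm _ (rem u r ++ [:: u])); last 2 first.
- exact: nice_tie.
- by rewrite perm_sym perm_catC perm_sym; exact: perm_to_rem.
rewrite iter_int_cat (_ : iter_int [:: u] _ = fun=> 0) ?iter_int_cst//.
apply/funext => y /=; rewrite /upd eqxx eq_sym (negbTE uv).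
have U0 : (U01 [set (y v : RT)] = 0)%E.
  have := @dominates_uniform_prob R 0 1 ltr01.
  move=> /null_content_dominatesP; apply => //; exact: lebesgue_measure_set1.
rewrite /Rintegral (_ : (fun z => _) = (fun z => (\1_[set (y v : RT)] z)%:E)).
  by rewrite integral_indic//= setIT U0.
apply/funext => z; rewrite indicE; congr (_%:R%:E); congr nat_of_bool.
by apply/eqP/idP => [->|]; rewrite inE.
Qed.

(** The passage from tuples, on which [lebesgue_tuple] lives, to points with named coordinates. *)
Fixpoint fill r (s : seq R) x : V -> R :=
  match r, s with
  | v :: r', y :: s' => fill r' s' (upd x v y)
  | _, _ => x
  end.

Lemma fillE r s x u : uniq r -> size s = size r ->
  fill r s x u = if u \in r then nth 0 s (index u r) else x u.
Proof.
elim: r s x => [|v r IH] [|y s] x //= /andP[vr ur] [sr].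
rewrite IH// in_cons (eq_sym v u) /upd.
by case: eqVneq => //= ->; rewrite (negbTE vr).
Qed.

Lemma integral_uniform01 (h : RT -> R) : measurable_fun setT h ->
  (\int[U01]_y (h y)%:E = \int[lebesgue_measure]_(y in `[0%R, 1%R]) (h y)%:E)%E.
Proof.
move=> mh.
have mE : measurable_fun setT (fun y => (h y)%:E) by exact/measurable_EFinP.
rewrite [LHS]integralE [RHS]integralE !integral_uniform//.
- by rewrite subr0 invr1 !mul1e.
- exact: measurable_funeneg.
- exact: measurable_funepos.
Qed.

Lemma measurable_unit_cube n : measurable (@unit_cube R n).
Proof.
rewrite (_ : @unit_cube R n = \bigcap_(i in [set: 'I_n])
    ((fun s : n.-tuple RT => tnth s i) @^-1` `[0, 1])).
  apply: fin_bigcap_measurable => // i _.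
  rewrite -[X in measurable X]setTI.
  by apply: (measurable_tnth i) => //; exact: measurable_itv.
apply/seteqP; split => s /= H i; first by move=> _; exact: H.
exact: H.
Qed.

Lemma unit_cube_cons n (p : RT * n.-tuple RT) :
  unit_cube (cons_pair p) <-> (p.1 \in `[0, 1]) /\ unit_cube p.2.
Proof.
split=> [H|[H1 H2] i].
  split=> [|i]; first by have := H ord0; rewrite (tnth_nth 0).
  by have := H (lift ord0 i); rewrite !(tnth_nth 0).
rewrite (tnth_nth 0); case: (unliftP ord0 i) => [j|] -> //=.
by have := H2 j; rewrite (tnth_nth 0).
Qed.

Lemma measurable_fill n d (T : measurableType d) (g : V -> T -> RT) (s : T -> n.-tuple RT) r u :
  (forall v, measurable_fun setT (g v)) -> measurable_fun setT s ->
  measurable_fun setT (fun t => fill r (s t) (g^~ t) u : RT).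
Proof.
elim: r n g s => [|v r IH] [|n] g s mg ms //=.
  by under eq_fun => t do rewrite (tuple0 (s t))/=; exact: mg.
- under eq_fun => t do rewrite (tuple_eta (s t))/=.
  apply: (IH n (fun w t => upd (g^~ t) v (thead (s t)) w)
    (fun t => [tuple of behead (s t)])).
  + move=> w; rewrite /upd; case: eqP => // _.
    by apply: measurableT_comp => //; exact: measurable_tnth.
  + exact: (measurableT_comp (@measurable_behead _ RT n) ms).
Qed.

(** Induction on [n]: the pushforward along [cons_pair] is undone, and Fubini peels off the head
    coordinate, whose cube factor becomes the uniform law on the unit interval. *)
Lemma integral_lebesgue_tuple n r F x : size r = n -> nice F ->
  (\int[lebesgue_tuple n]_(s in @unit_cube R n) (F (fill r s x))%:E =
   (iter_int r F x)%:E)%E.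
Proof.
elim: n r F x => [|n IH] [|v r] F x //= => [_ nF|[rn] nF].
  rewrite integral_dirac//; last exact: measurable_unit_cube.
  by rewrite diracE mem_set ?mul1e// => -[].
have mcube := @measurable_unit_cube n.
(* The mass of the smaller cube is the induction hypothesis at the constant function 1; it gives the
   finiteness needed for integrability. *)
have cube1 : (lebesgue_tuple n (@unit_cube R n) = 1)%E.
  have := IH r (fun=> 1) x rn (nice_cst 1).
  by rewrite integral_cst//= mul1e iter_int_cst.
have nK := nice_iter_int r nF.
pose f (s : n.+1.-tuple RT) := F (fill (v :: r) s x).
have mf : measurable_fun setT f.
  have [_ /(_ _ (n.+1.-tuple RT : measurableType _)
    (fun u s => fill (v :: r) s x u))] := nF; apply => u.
  exact: (@measurable_fill n.+1 _ _ (fun u => cst (x u)) id).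
pose h p := f (@cons_pair R n p).
have mh : measurable_fun setT h by exact: measurableT_comp (@measurable_cons_pair R n).
pose D := (`[0, 1]%classic : set RT) `*` @unit_cube R n.
have DE : @cons_pair R n @^-1` @unit_cube R n.+1 = D.
  by apply/seteqP; split=> p /= /unit_cube_cons.
have mD : measurable D by apply: measurableX.
have D1 : ((@lebesgue_measure R \x lebesgue_tuple n) D < +oo)%E.
  rewrite /D [ltLHS]product_measure1E//=.
  by rewrite cube1 mule1 lebesgue_measure_itv/= lte01 oppr0 adde0 ltry.
have ih : (@lebesgue_measure R \x lebesgue_tuple n)%E.-integrable D (EFin \o h).
  apply: measurable_bounded_integrable => //; first exact: measurable_funTS.
  have [[M FM] _] := nF; exists M; split; first exact: num_real.
  by move=> K MK p _; exact: le_trans (FM _) (ltW MK).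
have mcp := @measurable_cons_pair R n.
rewrite (eq_measure_integral
  (measure_function_pushforward__canonical__measure_function_Measure
    (@lebesgue_measure R \x lebesgue_tuple n)%E mcp)) //.
rewrite (@integral_pushforward _ _ _ _ _ _ mcp _ _ (EFin \o f)).
- rewrite DE integral_mkcond/= -integral12_prod_meas1/=; last first.
    by rewrite -integrable_mkcond.
  transitivity (\int[lebesgue_measure]_y (((fun y => (iter_int r F (upd x v y))%:E)
      \_ (`[0%R, 1%R]%classic : set RT)) y))%E.
    apply: eq_integral => y _; rewrite /fubini_F patchE; case: ifPn => y01.
      rewrite -IH// [RHS]integral_mkcond; apply: eq_integral => s _.
      rewrite !patchE; congr (if _ then _ else _).
      apply/idP/idP => /set_mem ss; apply/mem_set; first by case: ss.
      by split=> //; exact: set_mem y01.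
    apply: integral0_eq => s _; rewrite patchE ifN//.
    by apply: contra y01; rewrite !inE => -[].
  rewrite -integral_mkcond -integral_uniform01.
    rewrite /Rintegral fineK//; apply: integrable_fin_num => //.
    exact: nice_upd_integrable.
  have [_ /(_ _ RT (fun u y => upd x v y u))] := nK; apply => u.
  by rewrite /upd; case: eqP.
- exact/measurable_EFinP.
- by rewrite DE.
- exact: measurable_unit_cube.
Qed.

End IteratedIntegral.

(** * Symmetrization: from the simplex to the cube *)

Section Symmetrization.
Context {R : realType} (n : nat).
Local Notation RT := (measurableTypeR R).
Implicit Types (x : 'I_n -> R) (F : ('I_n -> R) -> R).

(** A product of 0/1 factors, so that [nice_prod] reduces its niceness to single comparisons. *)
Definition sorted_ind x : R :=
  \prod_(i < n) \prod_(j < n | (i <= j)%N) (x i <= x j)%R%:R.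

Lemma sorted_indE x :
  sorted_ind x = [forall i : 'I_n, forall j : 'I_n, (i <= j)%N ==> (x i <= x j)]%:R.
Proof.
rewrite /sorted_ind.
have [/forallP h|] := boolP [forall i : 'I_n, forall j : 'I_n, (i <= j)%N ==> (x i <= x j)].
  rewrite big1// => i _; rewrite big1// => j ij.
  by have /forallP/(_ j) := h i; rewrite ij /= => ->.
rewrite negb_forall => /existsP[i]; rewrite negb_forall => /existsP[j].
rewrite negb_imply => /andP[ij /negbTE xij].
by rewrite (bigD1 i)//= (bigD1 j)//= xij !mul0r.
Qed.

Lemma perm_eq_map_enum (p : {perm 'I_n}) :
  perm_eq [seq p i | i <- enum 'I_n] (enum 'I_n).
Proof.
apply: uniq_perm; rewrite ?enum_uniq//.
  by rewrite map_inj_uniq ?enum_uniq//; exact: perm_inj.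
move=> i; rewrite mem_enum; apply/mapP; exists (p^-1 i)%g; rewrite ?mem_enum//.
by rewrite permKV.
Qed.

Lemma sorted_ind_sorted x :
  sorted_ind x = (sorted <=%R [seq x i | i <- enum 'I_n])%:R.
Proof.
have nthE (i : 'I_n) : nth 0 [seq x i | i <- enum 'I_n] i = x i.
  by rewrite (nth_map i) ?size_enum_ord// nth_ord_enum.
rewrite sorted_indE; congr (nat_of_bool _)%:R; apply/idP/idP.
  move=> /forallP h; apply/(sortedP 0) => k.
  rewrite size_map size_enum_ord => kn; have kn' := ltnW kn.
  have := nthE (Ordinal kn); have := nthE (Ordinal kn') => /= -> ->.
  by have /forallP/(_ (Ordinal kn))/implyP := h (Ordinal kn'); apply.
move=> h; apply/forallP => i; apply/forallP => j; apply/implyP => ij.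
rewrite -(nthE i) -(nthE j).
apply: (sorted_leq_nth le_trans lexx _ h) => //.
  by rewrite inE size_map size_enum_ord.
by rewrite inE size_map size_enum_ord.
Qed.

(** Sorting supplies one permutation; any other agrees with it because two sorted lists with the
    same content are equal and [x] is injective. *)
Lemma sorted_ind_perm_sum x : injective x ->
  \sum_(p : {perm 'I_n}) sorted_ind (x \o p) = 1.
Proof.
move=> xinj.
have key (p : {perm 'I_n}) : sorted_ind (x \o p) =
    (sorted <=%R [seq x (p i) | i <- enum 'I_n])%:R by exact: sorted_ind_sorted.
pose t := [tuple x i | i < n].
have : perm_eq (sort <=%R t) t by rewrite perm_sort.
move=> /tuple_permP[p0 tp0].
have sp0 : [seq x (p0 i) | i <- enum 'I_n] = sort <=%R t.
  rewrite tp0; apply: eq_map => i; by rewrite tnth_mktuple.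
rewrite (bigD1 p0)//= key sp0 sort_le_sorted big1 ?addr0// => p pp0.
rewrite key; case: (boolP (sorted _ _)) => // sp; case/eqP: pp0.
apply/permP => i; apply: xinj.
have : [seq x (p i) | i <- enum 'I_n] = [seq x (p0 i) | i <- enum 'I_n].
  apply: (sorted_eq le_trans le_anti) => //.
    by rewrite sp0 sort_le_sorted.
  rewrite (map_comp x p) (map_comp x p0); apply: perm_map.
  by rewrite (perm_trans (perm_eq_map_enum p))// perm_sym perm_eq_map_enum.
by move/eq_in_map; apply; rewrite mem_enum.
Qed.

Lemma nice_sorted_ind : nice sorted_ind.
Proof.
apply: nice_prod => i; apply: nice_prod => j; split=> [|d T g mg].
  by exists 1 => x; case: (x i <= x j); rewrite ?normr1 ?normr0.
pose b2r (b : bool) : RT := b%:R.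
apply: (@measurableT_comp _ _ _ _ _ _ b2r) => //.
exact: (@measurable_fun_ler _ _ R _ (g i) (g j) (mg i) (mg j)).
Qed.

(* Off the null set where two coordinates coincide, exactly one permutation
   sorts a point. *)
Lemma iter_int_symmetrize F : nice F ->
  (forall (p : {perm 'I_n}) x, F (x \o p) = F x) ->
  iter_int (enum 'I_n) F (fun=> 0) =
  n`!%:R * iter_int (enum 'I_n) (fun x => F x * sorted_ind x) (fun=> 0).
Proof.
move=> nF symF.
pose S x := \sum_(p : {perm 'I_n}) sorted_ind (x \o p).
have nSp (p : {perm 'I_n}) : nice (fun x => sorted_ind (x \o p)).
  have [[M SM] mS] := nice_sorted_ind; split; first by exists M => x.
  by move=> d T g mg; apply: (mS _ _ (fun v => g (p v))) => v; exact: mg.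
have nS : nice S by exact: nice_sum.
(* [Tie] counts coinciding coordinates: its integral is zero, yet it is at least 1 wherever [x] is
   not injective. *)
pose Tie x : R := \sum_(i < n) \sum_(j < n | i != j) (x i == x j)%:R.
have nT : nice Tie.
  by apply: nice_sum => i; apply: nice_sum => j; exact: nice_tie.
have Tie0 : iter_int (enum 'I_n) Tie (fun=> 0) = 0.
  rewrite iter_int_sum; last by move=> i; apply: nice_sum => j; exact: nice_tie.
  rewrite big1// => i _; rewrite iter_int_sum; last by move=> j; exact: nice_tie.
  by rewrite big1// => j ij; rewrite iter_int_tie// mem_enum.
have Tie_ge0 x : 0 <= Tie x by do 2 apply: sumr_ge0 => ? _.
have Tie_ge1 x : ~ injective x -> 1 <= Tie x.
  move=> /injectiveP/injectivePn[i [j ij xij]].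
  rewrite /Tie (bigD1 i)//= (bigD1 j)//= xij eqxx -addrA lerDl addr_ge0//.
    exact: sumr_ge0.
  by do 2 apply: sumr_ge0 => ? _.
have FS : iter_int (enum 'I_n) (fun x => F x * S x) (fun=> 0) =
    iter_int (enum 'I_n) F (fun=> 0).
  have [[M FM] _] := nF; have [[N SN] _] := nS.
  have nFS : nice (fun x => F x * S x) by exact: niceM.
  have M0 : 0 <= M := le_trans (normr_ge0 _) (FM (fun=> 0)).
  have N0 : 0 <= N := le_trans (normr_ge0 _) (SN (fun=> 0)).
  have nKT : nice (fun x => M * (N + 1) * Tie x).
    by apply: niceM => //; exact: nice_cst.
  have KT0 : iter_int (enum 'I_n) (fun x => M * (N + 1) * Tie x) (fun=> 0) = 0.
    by rewrite iter_intZ// Tie0 mulr0.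
  (* The constant comes from the bound [M] on [F] and the bound [N + 1] on [S x - 1]. *)
  have bound x : `|F x * S x - F x| <= M * (N + 1) * Tie x.
    have [xi|xi] := pselect (injective x).
      rewrite /S sorted_ind_perm_sum// mulr1 subrr normr0.
      by rewrite !mulr_ge0// addr_ge0.
    rewrite -{2}(mulr1 (F x)) -mulrBr normrM -mulrA ler_pM//.
    apply: (@le_trans _ _ (N + 1)).
      by rewrite (le_trans (ler_normB _ _))// normr1 lerD2r.
    by rewrite ler_peMr ?addr_ge0// Tie_ge1.
  apply/eqP; rewrite eq_le; apply/andP; split.
    have := iter_intD (enum 'I_n) (fun=> 0) nF nKT; rewrite KT0 addr0 => <-.
    apply: iter_int_le => //.
      exact: niceD.
    by move=> x; rewrite addrC -lerBlDr (le_trans (ler_norm _)).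
  have := iter_intD (enum 'I_n) (fun=> 0) nFS nKT; rewrite KT0 addr0 => <-.
  apply: iter_int_le => //.
    exact: niceD.
  by move=> x; rewrite addrC -lerBlDr (le_trans (ler_norm _))// distrC.
rewrite -FS.
have -> : (fun x => F x * S x) = (fun x => \sum_(p : {perm 'I_n}) F x * sorted_ind (x \o p)).
  by apply/funext => x; rewrite mulr_sumr.
rewrite iter_int_sum; last by move=> p; exact: niceM.
rewrite (eq_bigr (fun=> iter_int (enum 'I_n) (fun x => F x * sorted_ind x) (fun=> 0))).
  by rewrite sumr_const mulr_natl -card_Sn; congr (_ *+ _); exact: eq_card.
move=> p _.
pose G x := F x * sorted_ind x.
have nG : nice G by apply: niceM => //; exact: nice_sorted_ind.
(* By symmetry of [F] the permutation can be absorbed into the names of the coordinates, whose order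
   of integration is irrelevant. *)
transitivity (iter_int [seq (p^-1)%g i | i <- enum 'I_n] G (fun=> 0)).
  rewrite [RHS](@iter_int_map _ _ (p^-1)%g p); [|exact: permKV|exact: permK].
  by congr (iter_int _ _ _); apply/funext => x; rewrite /G symF.
by apply: iter_int_perm => //; exact: perm_eq_map_enum.
Qed.
End Symmetrization.

(** * Connected components *)

Section Components.
Variables (V : finType) (H : multigraph V).

Lemma connect_homo (T1 T2 : finType) (e1 : rel T1) (e2 : rel T2) (h : T1 -> T2) :
  {homo h : x y / e1 x y >-> e2 x y} ->
  {homo h : x y / connect e1 x y >-> connect e2 x y}.
Proof.
move=> he x _ /connectP[p px ->]; elim: p x px => [|y p IH] x /=; first by [].
by move=> /andP[/he/connect1 xy /IH]; exact: connect_trans.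
Qed.

Lemma mult_submultigraph (A : {set V}) (a b : {v | v \in A}) :
  mult (submultigraph H A) a b = mult H (val a) (val b).
Proof.
rewrite /mult ffunE; congr (H _); apply: val_inj => /=.
by rewrite imsetU !imset_set1.
Qed.

Lemma adjacent_submultigraph (A : {set V}) (a b : {v | v \in A}) :
  Defs.adjacent (submultigraph H A) a b = (0 < mult H (val a) (val b))%N.
Proof. by rewrite -mult_submultigraph. Qed.

Lemma mg_connected_set1 v : mg_connected (submultigraph H [set v]).
Proof.
apply/forallP => -[a av]; apply/forallP => -[b bv]; apply/implyP => /eqP ab.
by case: ab; apply: val_inj; move: av bv; rewrite /= !inE => /eqP-> /eqP->.
Qed.

Lemma mg_connected_set2 u v : (0 < mult H u v)%N ->
  mg_connected (submultigraph H [set u; v]).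
Proof.
move=> uv; have vu : (0 < mult H v u)%N by rewrite /mult pair_edgeC.
apply/forallP => -[a av]; apply/forallP => -[b bv]; apply/implyP => /eqP ab.
apply: connect1; rewrite adjacent_submultigraph /=.
move: (av) (bv); rewrite !inE => /orP[] /eqP au /orP[] /eqP bu; rewrite au bu //.
  by case: ab; apply: val_inj; rewrite /= au bu.
by case: ab; apply: val_inj; rewrite /= au bu.
Qed.

(** Any two vertices are joined through [w]; a path inside one part is carried into the union by
    [connect_homo]. *)
Lemma mg_connected_setU (A B : {set V}) w : w \in A -> w \in B ->
  mg_connected (submultigraph H A) -> mg_connected (submultigraph H B) ->
  mg_connected (submultigraph H (A :|: B)).
Proof.
move=> wA wB cA cB.
have wU : w \in A :|: B by rewrite inE wA.
have cw (C : {set V}) (a b : V) (aC : a \in C) (bC : b \in C)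
    (aU : a \in A :|: B) (bU : b \in A :|: B) : C \subset A :|: B ->
    mg_connected (submultigraph H C) ->
    connect (Defs.adjacent (submultigraph H (A :|: B))) (exist _ a aU) (exist _ b bU).
  move=> /fintype.subsetP CU /forallP/(_ (exist _ a aC))/forallP/(_ (exist _ b bC)).
  case: eqVneq => [[ab] _|_ /=].
    by rewrite (_ : exist _ a aU = exist _ b bU)//; apply: val_inj.
  move=> /(connect_homo (h := fun c : {v | v \in C} =>
    exist (fun v => v \in A :|: B) (val c) (CU _ (valP c)))
    (e2 := Defs.adjacent (submultigraph H (A :|: B)))).
  move=> h; have {h} := h _; rewrite /=.
  set a' := exist _ a _; set b' := exist _ b _ => h.
  rewrite (_ : exist _ a aU = a'); last exact: val_inj.
  rewrite (_ : exist _ b bU = b'); last exact: val_inj.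
  by apply: h => x y; rewrite !adjacent_submultigraph.
apply/forallP => -[a aU]; apply/forallP => -[b bU]; apply/implyP => _.
apply: (@connect_trans _ _ (exist _ w wU)).
  case: (finset.setUP aU) => aC; first by apply: (cw A) => //; exact: finset.subsetUl.
  by apply: (cw B) => //; exact: finset.subsetUr.
case: (finset.setUP bU) => bC; first by apply: (cw A) => //; exact: finset.subsetUl.
by apply: (cw B) => //; exact: finset.subsetUr.
Qed.

(** Maximality of [A] is tested against the connected set [A :|: B]. *)
Lemma components_absorb (A B : {set V}) w : A \in components H ->
  mg_connected (submultigraph H B) -> w \in A -> w \in B -> B \subset A.
Proof.
rewrite inE => /maxsetP[cA maxA] cB wA wB.
have {}maxA := maxA _ (mg_connected_setU wA wB cA cB) (finset.subsetUl A B).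
by apply/fintype.subsetP => x xB; rewrite -maxA inE xB orbT.
Qed.

Lemma components_eq (A B : {set V}) w : A \in components H -> B \in components H ->
  w \in A -> w \in B -> A = B.
Proof.
move=> AC BC wA wB; apply/eqP; rewrite finset.eqEsubset.
move: (AC) (BC); rewrite !inE => /maxsetP[cA _] /maxsetP[cB _].
by rewrite (components_absorb BC cA wB wA) (components_absorb AC cB wA wB).
Qed.

Lemma components_cover v : exists2 A, A \in components H & v \in A.
Proof.
have [A mA] := @maxset_exists _ (fun B => mg_connected (submultigraph H B)) _
  (mg_connected_set1 v).
by rewrite finset.sub1set => vA; exists A => //; rewrite inE.
Qed.

Lemma components_edge A u v : A \in components H -> (0 < mult H u v)%N ->
  u \in A -> v \in A.
Proof.
move=> AC uv uA; have := components_absorb AC (mg_connected_set2 uv) uA.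
by rewrite !inE eqxx => /(_ isT)/fintype.subsetP; apply; rewrite !inE eqxx orbT.
Qed.

End Components.

Section Factorization.
Context {R : realType}.
Local Notation RT := (measurableTypeR R).

(* Meaningful for symmetric [g]: the chosen orientation is then irrelevant. *)
Definition edge_eval (V : finType) (g : R * R -> R) (E : edge V) (x : V -> R) : R :=
  if [pick p : V * V | pair_edge p.1 p.2 == E] is Some p then g (x p.1, x p.2) else 1.

Lemma edge_eval_pair (V : finType) (g : R * R -> R) (u v : V) x :
  (forall s t, g (s, t) = g (t, s)) ->
  edge_eval g (pair_edge u v) x = g (x u, x v).
Proof.
move=> gC; rewrite /edge_eval; case: pickP => [[a b] /=|/(_ (u, v))]; last by rewrite eqxx.
by rewrite pair_edge_eq => /orP[] /eqP[-> ->].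
Qed.

Variable g : R * R -> R.
Hypothesis gC : forall s t, g (s, t) = g (t, s).
Hypothesis nice_g : forall (V : eqType) (u v : V), nice (fun x : V -> R => g (x u, x v)).

Section Multigraph.
Variables (V : finType) (H : multigraph V).

Definition set_integrand (A : {set V}) (x : V -> R) : R :=
  \prod_(E : edge V | val E \subset A) edge_eval g E x ^+ H E.

Lemma nice_edge_eval (E : edge V) : nice (edge_eval g E).
Proof.
by rewrite /edge_eval; case: pickP => [p _|_]; [exact: nice_g|exact: nice_cst].
Qed.

Lemma nice_set_integrand A : nice (set_integrand A).
Proof. by apply: nice_prod => E; apply: niceX; exact: nice_edge_eval. Qed.

Lemma depends_on_set_integrand (A : {set V}) : depends_on (mem A) (set_integrand A).
Proof.
move=> x y xy; apply: eq_bigr => E; have [u [v ->]] := edgeP E.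
by rewrite finset.subUset !finset.sub1set => /andP[uA vA]; rewrite !edge_eval_pair// !xy.
Qed.

(** An edge of positive multiplicity lies in exactly one component. Edges across components have
    multiplicity 0 and contribute the factor 1. *)
Lemma integrand_components x : \prod_E edge_eval g E x ^+ H E =
  \prod_(L in components H) set_integrand L x.
Proof.
rewrite (exchange_big_dep xpredT)//=; apply: eq_bigr => E _.
have [HE|HE] := posnP (H E).
  by rewrite HE expr0 big1.
have [u [v Euv]] := edgeP E.
have [A AC uA] := components_cover H u.
have vA : v \in A by apply: components_edge AC _ uA; rewrite /mult -Euv.
rewrite (big_pred1 A)// => B; rewrite Euv /= finset.subUset !finset.sub1set.
apply/andP/eqP => [[BC /andP[uB vB]]|->]; first exact: components_eq BC AC uB uA.
by rewrite AC uA vA.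
Qed.

Lemma iter_int_components x :
  iter_int (enum V) (fun x => \prod_E edge_eval g E x ^+ H E) x =
  \prod_(L in components H) iter_int (enum L) (set_integrand L) x.
Proof.
have -> : (fun x => \prod_E edge_eval g E x ^+ H E) =
    (fun x => \prod_(L <- enum (components H)) set_integrand L x).
  by apply/funext => y; rewrite integrand_components big_enum.
rewrite -[RHS]big_enum /=.
(* Generalized to duplicate-free lists of components, so that induction can split off one block of
   variables at a time. *)
have step (s : seq {set V}) y : uniq s -> {subset s <= components H} ->
    iter_int (flatten [seq enum (L : {set V}) | L <- s])
      (fun x => \prod_(L <- s) set_integrand L x) y =
    \prod_(L <- s) iter_int (enum L) (set_integrand L) y.
  elim: s => [|L s IH] /=; first by move=> _ _; rewrite !big_nil.
  move=> /andP[Ls us] sC.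
  rewrite (_ : (fun x => \prod_(B <- L :: s) set_integrand B x) =
    (fun x => set_integrand L x * \prod_(B <- s) set_integrand B x)); last first.
    by apply/funext => x0; rewrite big_cons.
  rewrite big_cons -IH//; last by move=> B Bs; apply: sC; rewrite in_cons Bs orbT.
  apply: (iter_int_prod (B := mem L)
    (C := fun v => has (fun B : {set V} => v \in B) s)).
  - exact: nice_set_integrand.
  - by apply: nice_prod => B; exact: nice_set_integrand.
  - exact: depends_on_set_integrand.
  - move=> a b ab; apply: eq_big_seq => B Bs.
    by apply: depends_on_set_integrand => v vB; apply: ab; apply/hasP; exists B.
  - move=> v; rewrite mem_enum => vL; apply/hasPn => B Bs; apply: contra Ls => vB.
    rewrite (components_eq (sC L (mem_head _ _)) (sC B _) vL vB)//.
    by rewrite in_cons Bs orbT.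
  - move=> v /flatten_mapP[B Bs]; rewrite mem_enum => vB; apply: contra Ls => vL.
    rewrite (components_eq (sC L (mem_head _ _)) (sC B _) vL vB)//.
    by rewrite in_cons Bs orbT.
rewrite -step ?enum_uniq//; last by move=> B; rewrite mem_enum.
(* Components partition the vertices, so the blocks placed end to end permute [enum V]. *)
apply: iter_int_perm.
  by apply: nice_prod => B; exact: nice_set_integrand.
rewrite perm_sym; apply: uniq_perm; rewrite ?enum_uniq//; last first.
  move=> v; rewrite mem_enum; apply/flatten_mapP.
  by have [A AC vA] := components_cover H v; exists A; rewrite mem_enum.
have : {subset enum (components H) <= components H} by move=> B; rewrite mem_enum.
have := enum_uniq (components H).
elim: (enum (components H)) => //= L s IH /andP[Ls us] sC.
rewrite cat_uniq enum_uniq IH//= ?andbT; last first.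
  by move=> B Bs; apply: sC; rewrite in_cons Bs orbT.
apply/hasPn => v /flatten_mapP[B Bs]; rewrite !mem_enum => vB; apply: contra Ls => vL.
rewrite (components_eq (sC L (mem_head _ _)) (sC B _) vL vB)//.
by rewrite in_cons Bs orbT.
Qed.

End Multigraph.

Lemma integral_along_set (f : R * R -> R) (V : finType) (H : multigraph V) (L : {set V}) :
  (forall s t, s \in `[0, 1] -> t \in `[0, 1] -> g (s, t) = f (s, t)) ->
  integral_along f (submultigraph H L) = iter_int (enum L) (set_integrand H L) (fun=> 0).
Proof.
move=> gf; pose V' : finType := {v : V | v \in L}.
(* [integral_along] orders its variables by the enumeration of the subtype; [r] is that order
   transported to [V], a permutation of [enum L]. *)
pose r : seq V := [seq val v | v <- enum V'].
have sr : size r = #|V'| by rewrite size_map -cardE.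
have ur : uniq r by rewrite map_inj_uniq ?enum_uniq//; exact: val_inj.
have pr : perm_eq r (enum L).
  apply: uniq_perm; rewrite ?enum_uniq// => v; rewrite mem_enum; apply/mapP/idP.
    by move=> [w _ ->]; exact: valP.
  by move=> vL; exists (exist _ v vL); rewrite ?mem_enum.
rewrite -(iter_int_perm _ (nice_set_integrand H L) pr).
rewrite /integral_along /Rintegral -[RHS]/(fine (EFin _)).
rewrite -(integral_lebesgue_tuple _ sr (nice_set_integrand H L)).
congr fine; apply: eq_integral => s /set_mem cs; congr EFin.
pose F (E : edge V) := edge_eval g E (fill r s (fun=> 0)) ^+ H E.
transitivity (\prod_(E' : edge V') F (image_edge val E')).
  rewrite -(ordered_pairs_edges _ (fun E' : edge V' => F (image_edge val E'))).
  apply: eq_bigr => a _; apply: eq_bigr => b _.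
  have E (c d : V') : image_edge val (pair_edge c d) = pair_edge (val c) (val d).
    by apply: val_inj; rewrite /= imsetU !imset_set1.
  rewrite /F /mult /submultigraph ffunE E edge_eval_pair// -gf//.
  have fE (c : 'I_#|V'|) : fill r s (fun=> 0) (val (enum_val c)) = tnth s c.
    rewrite fillE ?size_tuple// map_f ?mem_enum// index_map; last exact: val_inj.
    by rewrite (tnth_nth 0) (enum_val_nth (enum_val c)) index_uniq ?enum_uniq// -cardE.
  by rewrite !fE.
have inj : {in [set: edge V']%SET &, injective (image_edge (val : V' -> V))}.
  by move=> E1 E2 _ _ /(congr1 val)/(imset_inj val_inj)/val_inj.
transitivity (\prod_(E' in [set: edge V']%SET) F (image_edge val E')).
  by apply: eq_bigl => E; rewrite inE.
rewrite -(big_imset F inj); apply: eq_bigl => E.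
apply/imsetP/idP => [[E' _ ->]|]; first by apply/fintype.subsetP => v /imsetP[w _ ->]; exact: valP.
have [u [v ->]] := edgeP E; rewrite finset.subUset !finset.sub1set => /andP[uL vL].
exists (pair_edge (exist _ u uL) (exist _ v vL)); rewrite ?inE//.
by apply: val_inj; rewrite /= imsetU !imset_set1.
Qed.

End Factorization.

(** * Gaussian processes and multigraph sums *)

Section Clamp.
Context {R : realType}.
Local Notation RT := (measurableTypeR R).

Definition clamp (y : R) : R := Num.max 0 (Num.min 1 y).

Lemma clamp_itv y : clamp y \in `[0, 1].
Proof. by rewrite in_itv/= le_max lexx/= ge_max ler01 ge_min lexx. Qed.

Lemma clamp_id y : y \in `[0, 1] -> clamp y = y.
Proof. by rewrite in_itv/= => /andP[y0 y1]; rewrite /clamp (min_idPr y1) (max_idPr y0). Qed.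

Lemma measurable_clamp : measurable_fun setT (clamp : RT -> RT).
Proof. by apply: measurable_maxr => //; apply: measurable_minr. Qed.

(** An open set of the plane is a countable union of open rectangles with rational endpoints. *)
Lemma measurable_open_pair (U : set (R * R)) d (T : measurableType d) (a b : T -> RT) :
  open U -> measurable_fun setT a -> measurable_fun setT b ->
  measurable [set t | U (a t, b t)].
Proof.
move=> oU ma mb.
pose I (p : rat * rat) : set R := `]ratr p.1, ratr p.2[%classic.
pose B (q : (rat * rat) * (rat * rat)) : set T :=
  if pselect (I q.1 `*` I q.2 `<=` U) then a @^-1` I q.1 `&` b @^-1` I q.2 else set0.
have -> : [set t | U (a t, b t)] = \bigcup_q B q.
  apply/seteqP; split=> [t /= Ut|t [q _]]; last first.
    by rewrite /B; case: pselect => //= qU [h1 h2]; exact: qU.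
  have itv (y : R) (S : set R) : nbhs y S -> exists p, I p y /\ I p `<=` S.
    move=> /nbhs_ballP[e /= e0 eS].
    have [p1 h1] : exists q : rat, ratr q \in `]y - e, y[ by apply: rat_in_itvoo; rewrite gtrBl.
    have [p2 h2] : exists q : rat, ratr q \in `]y, y + e[ by apply: rat_in_itvoo; rewrite ltrDl.
    move: h1 h2; rewrite !in_itv/= => /andP[h1 h1'] /andP[h2 h2'].
    exists (p1, p2); rewrite /I/=; split; first by rewrite in_itv/= h1' h2.
    move=> z; rewrite /= in_itv/= => /andP[z1 z2]; apply: eS.
    by rewrite /ball/= ltr_distlC; apply/andP; split; lra.
  have [[S1 S2] /= [/itv[p1 [p1a p1S]] /itv[p2 [p2b p2S]]] SU] :
    nbhs (a t, b t) U by exact: open_nbhs_nbhs.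
  exists (p1, p2) => //; rewrite /B; case: pselect => [_|[]] /=; first by [].
  by move=> [x y] [/p1S h1 /p2S h2]; apply: SU.
apply: countable_bigcupT_measurable => // q; rewrite /B.
case: pselect => [h|h]; last exact: measurable0.
by apply: measurableI; rewrite -[X in measurable X]setTI;
  [apply: ma|apply: mb] => //; exact: measurable_itv.
Qed.

(* Clamping makes the integrands bounded and measurable on all of [R], so that
   iterated integrals need no domain conditions. *)
Definition clamped (f : R * R -> R) (p : R * R) : R := f (clamp p.1, clamp p.2).

Lemma nice_clamped (f : R * R -> R) (V : eqType) (u v : V) :
  {within `[0, 1] `*` `[0, 1], continuous f} ->
  nice (fun x : V -> R => clamped f (x u, x v)).
Proof.
move=> cf; split=> [|d T g mg].
  have cA : compact (`[0, 1] `*` `[0, 1] : set (R * R)).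
    by apply: compact_setX; exact: segment_compact.
  have /compact_bounded[M [Mr HM]] := continuous_compact cf cA.
  exists (`|M| + 1) => x; apply: HM.
    by rewrite (le_lt_trans (ler_norm M))// ltrDl.
  by exists (clamp (x u), clamp (x v)) => //; split; exact: clamp_itv.
apply: (measurability _ (RGenOpens.measurableE R)).
move=> _ [_ [a [b ->] <-]]; rewrite setTI.
pose A : set (R * R) := `[0, 1] `*` `[0, 1].
(* Continuity is relative to the square [A], so this preimage is only the trace on [A] of an open
   set [W]; clamped arguments always lie in [A], hence [W] itself can be used. *)
have oU : open (f @^-1` `]a, b[ : set (subspace A)).
  by move/continuousP : cf => cf'; exact/cf'/interval_open.
move: oU => /open_subspaceP[W oW WE].
have mc w : measurable_fun setT (fun t => clamp (g w t) : RT).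
  by apply: (measurableT_comp measurable_clamp); exact: mg.
rewrite (_ : _ @^-1` _ = [set t | W (clamp (g u t), clamp (g v t))]).
  exact: measurable_open_pair.
apply/funext => t; apply/propext.
have At : A (clamp (g u t), clamp (g v t)) by split; exact: clamp_itv.
have := congr1 (fun S : set (R * R) => S (clamp (g u t), clamp (g v t))) WE.
by rewrite /= !propeqE => -[h1 h2]; split=> h;
  [have [] := h2 (conj h At)|have [] := h1 (conj h At)].
Qed.

End Clamp.

Section Process.
Context (R : realType) (d : measure_display) (T : measurableType d)
  (P : probability T R) (m n : nat) (X : 'I_m -> R -> {RV P >-> R})
  (f : R * R -> R).
Hypothesis gX : gaussian_process `[0, 1] X.
Hypothesis X0 : forall i s, s \in `[0, 1] -> ('E_P[X i s] = 0)%E.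
Hypothesis covX : forall i j s t, s \in `[0, 1] -> t \in `[0, 1] ->
    covariance P (X i s) (X j t) = (f (s, t) * (i == j)%:R)%:E.

(** Symmetry of [f] on the square is inherited from the covariance of a single component, which
    exists because [0 < m]. *)
Lemma clamped_sym : (0 < m)%N -> forall s t, clamped f (s, t) = clamped f (t, s).
Proof.
move=> m0 s t; pose i := Ordinal m0.
have := covX i i (clamp_itv s) (clamp_itv t).
rewrite covarianceC covX ?clamp_itv// eqxx !mulr1 => -[].
by rewrite /clamped.
Qed.

Definition sample (x : 'I_n -> R) (j : 'I_m * 'I_n) : T -> R := X j.1 (clamp (x j.2)).

Lemma measurable_sample x j : measurable_fun setT (sample x j).
Proof. exact: measurable_funPT. Qed.

Lemma gaussian_sample x (c : 'I_m * 'I_n -> R) :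
  gaussian_rv P (fun w => \sum_j c j * sample x j w).
Proof.
have := @gX n (fun k => clamp (x k)) (fun k i => c (i, k))
  (fun k => clamp_itv (x k)).
congr (gaussian_rv P _); apply/funext => w.
rewrite exchange_big pair_bigA/=.
by apply: eq_bigr => -[].
Qed.

Lemma expectation_sample x j : (\int[P]_w (sample x j w)%:E = 0)%E.
Proof. by rewrite -[RHS](X0 j.1 (clamp_itv (x j.2))) unlock. Qed.

Lemma covariance_sample x q r u v : (0 < m)%N ->
  (\int[P]_w (sample x (q, u) w * sample x (r, v) w)%:E =
  (edge_eval (clamped f) (pair_edge u v) x * (q == r)%:R)%:E)%E.
Proof.
move=> m0; rewrite edge_eval_pair; last exact: clamped_sym.
rewrite /clamped -covX ?clamp_itv// covariance.unlock !X0 ?clamp_itv//.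
rewrite unlock; apply: eq_integral => w _; rewrite /=.
by rewrite mulrfctE /= !subr0.
Qed.

Definition total_degree (a : {ffun 'I_n -> multinom m}) : nat :=
  (\sum_(k < n) \sum_(i < m) a k i)%N.

Lemma total_degreeE (a : {ffun 'I_n -> multinom m}) :
  total_degree a = (\sum_(j : 'I_m * 'I_n) a j.2 j.1)%N.
Proof. by rewrite /total_degree exchange_big pair_bigA. Qed.

Lemma leq_total_degree (a : {ffun 'I_n -> multinom m}) k i : (a k i <= total_degree a)%N.
Proof. by rewrite total_degreeE (bigD1 (i, k))//= leq_addr. Qed.

(* A family of multigraphs with prescribed degrees has multiplicities bounded
   by [total_degree a], so it is encoded in a finite type. *)
Definition admissible (a : {ffun 'I_n -> multinom m})
    (h : {ffun 'I_m * edge 'I_n -> 'I_(total_degree a).+1}) : bool :=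
  [forall j : 'I_m * 'I_n, \sum_E incidence E j.2 * h (j.1, E) == a j.2 j.1]%N.

Definition wick_term (a : {ffun 'I_n -> multinom m})
    (h : {ffun 'I_m * edge 'I_n -> 'I_(total_degree a).+1}) (x : 'I_n -> R) : R :=
  (\prod_(j : 'I_m * 'I_n) (a j.2 j.1)`!)%N%:R *
  \prod_j ((edge_weight j.2 * edge_eval (clamped f) j.2 x) ^+ h j / (h j)`!%:R).

Lemma expectation_monomial (a : {ffun 'I_n -> multinom m}) x : (0 < m)%N ->
  P.-integrable setT (fun w => (\prod_(k < n) \prod_(i < m) X i (clamp (x k)) w ^+ a k i)%:E) /\
  (\int[P]_w (\prod_(k < n) \prod_(i < m) X i (clamp (x k)) w ^+ a k i)%:E =
   (\sum_(h | admissible (a := a) h) wick_term h x)%:E)%E.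
Proof.
move=> m0; pose N := total_degree a.
pose b : {ffun 'I_m * 'I_n -> 'I_N.+1} := [ffun j => inord (a j.2 j.1)].
have bE j : b j = a j.2 j.1 :> nat by rewrite ffunE inordK// ltnS leq_total_degree.
have ZE w : \prod_(k < n) \prod_(i < m) X i (clamp (x k)) w ^+ a k i =
    \prod_j sample x j w ^+ b j.
  rewrite exchange_big pair_bigA/=; apply: eq_bigr => j _.
  by rewrite bE.
have bN : (\sum_j b j = N)%N.
  rewrite [RHS]total_degreeE; apply: eq_bigr => j _; exact: bE.
have gS := gaussian_sample x; have mS := measurable_sample x.
split.
  under eq_fun do rewrite ZE.
  apply: (@all_moments_integrable _ _ _ P (fun w => \prod_j sample x j w ^+ b j)).
  exact: all_moments_monomial.
under eq_integral do rewrite ZE.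
rewrite (@wick _ _ _ P _ _ (sample x)
  (fun E => edge_eval (clamped f) E x) mS gS (expectation_sample x) _ N b bN); last first.
  by move=> q r u v; exact: covariance_sample.
congr EFin; rewrite mulr_sumr; apply: eq_big => [h|h _].
  by apply: eq_forallb => j; rewrite bE.
rewrite /wick_term; congr (_%:R * _).
by apply: eq_bigr => j _; rewrite bE.
Qed.

Lemma edge_sum_degree (G : multigraph 'I_n) : (\sum_v degree G v = (\sum_E G E).*2)%N.
Proof.
under eq_bigr do rewrite degree_incidence.
rewrite exchange_big -mul2n big_distrr; apply: eq_bigr => E _ /=.
by rewrite -big_distrl/= sum_incidence.
Qed.

Definition graphs_of (a : {ffun 'I_n -> multinom m})
    (h : {ffun 'I_m * edge 'I_n -> 'I_(total_degree a).+1}) :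
    {ffun 'I_m -> multigraph 'I_n} :=
  [ffun q => [ffun E => h (q, E) : nat]].

Lemma graphs_of_inj a : injective (@graphs_of a).
Proof.
move=> h1 h2 /ffunP h12; apply/ffunP => -[q E]; apply: val_inj.
by have := h12 q; rewrite !ffunE => /ffunP/(_ E); rewrite !ffunE.
Qed.

Lemma degree_graphs_of a (h : {ffun 'I_m * edge 'I_n -> 'I_(total_degree a).+1}) q v :
  degree (graphs_of h q) v = (\sum_E incidence E v * h (q, E))%N.
Proof. by rewrite degree_incidence; apply: eq_bigr => E _; rewrite !ffunE. Qed.

Lemma degree_admissible a (h : {ffun 'I_m * edge 'I_n -> 'I_(total_degree a).+1}) q v :
  admissible h -> degree (graphs_of h q) v = a v q.
Proof. by move=> /forallP adm; rewrite degree_graphs_of; exact/eqP/(adm (q, v)). Qed.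

(** The handshake identity in each multigraph. Hence an odd total degree leaves an empty sum over
    multigraphs, and the parity restriction of the statement drops only zero terms. *)
Lemma admissible_even a (h : {ffun 'I_m * edge 'I_n -> 'I_(total_degree a).+1}) :
  admissible h -> ~~ odd (total_degree a).
Proof.
move=> adm; rewrite {1}/total_degree exchange_big/=.
have -> : (\sum_(q < m) \sum_(k < n) a k q = \sum_(q < m) (\sum_E graphs_of h q E).*2)%N.
  apply: eq_bigr => q _; rewrite -edge_sum_degree; apply: eq_bigr => k _.
  by rewrite degree_admissible.
by rewrite -(big_morph _ doubleD (erefl : 0.*2 = 0)%N) odd_double.
Qed.

(** A sum over a set defaults to 0 on infinite support, so a finite list of indices must be
    exhibited. Each multiplicity is at most the sum of the degrees in its multigraph, hence at most
    [total_degree a], and every family comes from some [h]. *)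
Lemma fsbig_graphs (a : {ffun 'I_n -> multinom m}) (Phi : {ffun 'I_m -> multigraph 'I_n} -> R) :
  \sum_(G \in [set G : {ffun 'I_m -> multigraph 'I_n} |
      forall q j, degree (G q) j = a j q]) Phi G =
  \sum_(h | admissible (a := a) h) Phi (graphs_of h).
Proof.
rewrite (fsbigE [seq graphs_of h | h <- index_enum _ & @admissible a h]).
- rewrite big_map big_filter_cond; apply: eq_bigl => h.
  case: (boolP (admissible h)) => //= adm.
  by apply/mem_set => q j; exact: degree_admissible.
- by rewrite map_inj_uniq ?filter_uniq ?index_enum_uniq//; exact: graphs_of_inj.
- move=> G /= /mapP[h]; rewrite mem_filter => /andP[adm _] -> q j.
  exact: degree_admissible.
move=> G /= degG /mapP; case; pose N := total_degree a.
have GN q E : (G q E <= N)%N.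
  apply: (@leq_trans (\sum_E G q E)); first by rewrite (bigD1 E)//= leq_addr.
  apply: (@leq_trans (\sum_v degree (G q) v)).
    by rewrite edge_sum_degree -addnn leq_addr.
  rewrite (eq_bigr (fun v => a v q : nat)); last by move=> v _; exact: degG.
  by rewrite /N /total_degree exchange_big (bigD1 q)//= leq_addr.
exists [ffun j => inord (G j.1 j.2)].
  rewrite mem_filter mem_index_enum andbT; apply/forallP => -[q v] /=.
  rewrite -degG degree_incidence.
  by apply/eqP/eq_bigr => E _; rewrite ffunE /= inordK// ltnS.
apply/ffunP => q; apply/ffunP => E.
by rewrite !ffunE /= inordK// ltnS.
Qed.

End Process.

Section WickTerm.
Context (R : realType) (m n : nat) (f : R * R -> R).
Hypothesis cf : {within `[0, 1] `*` `[0, 1], continuous f}.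
Hypothesis fC : forall s t, clamped f (s, t) = clamped f (t, s).
Variable a : {ffun 'I_n -> multinom m}.

Lemma nice_wick_term (h : {ffun 'I_m * edge 'I_n -> 'I_(total_degree a).+1}) :
  nice (wick_term f h).
Proof.
apply: niceM; first exact: nice_cst.
apply: nice_prod => j; apply: niceM; last exact: nice_cst.
apply: niceX; apply: niceM; first exact: nice_cst.
by apply: nice_edge_eval => V u v; exact: nice_clamped.
Qed.

Variable h : {ffun 'I_m * edge 'I_n -> 'I_(total_degree a).+1}.
Hypothesis adm : admissible h.

(** The covariance is the same for all [q], so the powers of an edge value from the [m] multigraphs
    multiply to its power in their sum; weights and factorials form the symmetry factors. *)
Lemma wick_termE x : wick_term f h x =
  (\prod_(q < m) symmetry_factor R (graphs_of h q)) *
  \prod_E edge_eval (clamped f) E x ^+ (\sum_(q < m) graphs_of h q)%R E.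
Proof.
rewrite [X in _ = X * _](eq_bigr _ (fun q _ => symmetry_factorE (graphs_of h q))).
rewrite big_split/= -mulrA -natr_prod /wick_term; congr (_%:R * _).
  rewrite pair_bigA/=; apply: eq_bigr => -[q v] _ /=.
  by rewrite degree_admissible.
rewrite [X in _ * X](eq_bigr (fun E =>
    \prod_(q < m) edge_eval (clamped f) E x ^+ h (q, E))).
  rewrite [X in _ * X]exchange_big -big_split/= [LHS](eq_bigr (fun j =>
    (edge_weight j.2 * edge_eval (clamped f) j.2 x) ^+ h (j.1, j.2) /
      (h (j.1, j.2))`!%:R)); last by case.
  rewrite -(pair_bigA _ (fun q E =>
    (edge_weight E * edge_eval (clamped f) E x) ^+ h (q, E) /
      (h (q, E))`!%:R))/=.
  apply: eq_bigr => q _; rewrite -big_split; apply: eq_bigr => E _.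
  by rewrite !ffunE exprMn mulrAC.
move=> E _; rewrite sum_ffunE expr_sum; apply: eq_bigr => q _.
by rewrite !ffunE.
Qed.

Lemma iter_int_wick_term :
  iter_int (enum 'I_n) (wick_term f h) (fun=> 0) =
  (\prod_(q < m) symmetry_factor R (graphs_of h q)) *
  \prod_(L in components (\sum_(q < m) graphs_of h q))
    integral_along f (submultigraph (\sum_(q < m) graphs_of h q) L).
Proof.
have ng (V : eqType) (u v : V) : nice (fun x => clamped f (x u, x v)) by exact: nice_clamped.
rewrite (_ : wick_term f h = fun x => wick_term f h x)//; under eq_fun do rewrite wick_termE.
rewrite iter_intZ; last first.
  by apply: nice_prod => E; apply: niceX; exact: nice_edge_eval.
congr (_ * _); rewrite iter_int_components//; apply: eq_bigr => L _.
rewrite (integral_along_set fC ng)// => s t s01 t01.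
by rewrite /clamped /= !clamp_id.
Qed.

End WickTerm.

(** * Expansion of the polynomial and final assembly *)

Section Main.
Context (R : realType) (m n : nat) (f : R * R -> R) (Q : mpoly m R).

Definition exponents (phi : {ffun 'I_n -> 'I_(size (msupp Q))}) :
    {ffun 'I_n -> multinom m} :=
  [ffun k => tnth (in_tuple (msupp Q)) (phi k)].

Lemma exponents_inj : injective exponents.
Proof.
move=> p1 p2 /ffunP p12; apply/ffunP => k; have := p12 k; rewrite !ffunE => /eqP.
pose x0 := tnth (in_tuple (msupp Q)) (p1 k).
by rewrite !(tnth_nth x0)/= nth_uniq ?msupp_uniq// => /eqP/val_inj.
Qed.

Lemma prod_meval (v : 'I_n -> 'I_m -> R) :
  \prod_(k < n) meval (v k) Q =
  \sum_(phi : {ffun 'I_n -> 'I_(size (msupp Q))})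
    (\prod_(k < n) mcoeff (exponents phi k) Q) *
    \prod_(k < n) \prod_(i < m) v k i ^+ exponents phi k i.
Proof.
transitivity (\prod_(k < n) \sum_(j < size (msupp Q))
  (mcoeff (tnth (in_tuple (msupp Q)) j) Q *
   \prod_(i < m) v k i ^+ tnth (in_tuple (msupp Q)) j i)).
  by apply: eq_bigr => k _; rewrite mevalE big_tnth.
rewrite bigA_distr_bigA; apply: eq_bigr => phi _; rewrite big_split/=.
by congr (_ * _); apply: eq_bigr => k _; rewrite ffunE.
Qed.

(** A family outside the listed ones has some [a k] outside the support of [Q], so its coefficient
    vanishes; families of odd total degree vanish through [Phi]. *)
Lemma fsbig_exponents (Phi : {ffun 'I_n -> multinom m} -> R) :
  (forall a, odd (total_degree a) -> Phi a = 0) ->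
  \sum_(a \in [set a : {ffun 'I_n -> multinom m} |
                  ~~ odd (\sum_(k < n) \sum_(i < m) a k i)%N])
     (\prod_(k < n) mcoeff (a k) Q) * Phi a =
  \sum_phi (\prod_(k < n) mcoeff (exponents phi k) Q) * Phi (exponents phi).
Proof.
move=> Phi0.
rewrite (fsbigE [seq exponents phi | phi <- index_enum _ & ~~ odd (total_degree (exponents phi))]).
- rewrite big_map big_filter_cond [RHS](bigID (fun phi => odd (total_degree (exponents phi))))/=.
  rewrite [X in _ = X + _]big1 ?add0r; last by move=> phi /Phi0 ->; rewrite mulr0.
  apply: eq_bigl => phi; case: (boolP (odd _)) => //= ev.
  exact/mem_set.
- by rewrite map_inj_uniq ?filter_uniq ?index_enum_uniq//; exact: exponents_inj.
- by move=> a /= /mapP[phi]; rewrite mem_filter => /andP[ev _] aE; rewrite aE.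
move=> a /= oa ar.
suff : exists k, a k \notin msupp Q.
  by move=> [k]; rewrite -mcoeff_eq0 => /eqP ak; rewrite (bigD1 k)//= ak !mul0r.
apply/existsP; apply: contraR ar; rewrite negb_exists => /forallP ak.
have ix k : (index (a k) (msupp Q) < size (msupp Q))%N.
  by rewrite index_mem; have := ak k; rewrite negbK.
have aE : a = exponents [ffun k => Ordinal (ix k)].
  apply/ffunP => k; rewrite !ffunE (tnth_nth (a k))/= nth_index//.
  by have := ak k; rewrite negbK.
apply/mapP; exists [ffun k => Ordinal (ix k)] => //.
by rewrite mem_filter mem_index_enum andbT -aE.
Qed.
End Main.

Unset Implicit Arguments.

Theorem theorem2p4 (R : realType) (d : measure_display) (T : measurableType d)
    (P : probability T R) (m n : nat) (X : 'I_m -> R -> {RV P >-> R})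
    (f : R * R -> R) (Q : mpoly m R) :
  (0 < m)%N -> (0 < n)%N ->
  gaussian_process `[0, 1] X ->
  (forall i s, s \in `[0, 1] -> ('E_P[X i s] = 0)%E) ->
  {within `[0, 1] `*` `[0, 1], continuous f} ->
  (forall i j s t, s \in `[0, 1] -> t \in `[0, 1] ->
    covariance P (X i s) (X j t) = (f (s, t) * (i == j)%:R)%:E) ->
  (\int[lebesgue_tuple n]_(s in @ordered_simplex R n)
     'E_P[fun w => (\prod_(k < n)
            meval (fun i => X i (tnth s k) w) Q)%R])%E =
  ((n`!%:R)^-1 *
   \sum_(a \in [set a : {ffun 'I_n -> multinom m} |
                  ~~ odd (\sum_(k < n) \sum_(i < m) a k i)%N])
     (\prod_(k < n) mcoeff (a k) Q) *
     \sum_(G \in [set G : {ffun 'I_m -> multigraph 'I_n} |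
                    forall q j, degree (G q) j = a j q])
       ((\prod_(q < m) symmetry_factor R (G q)) *
        \prod_(L in components (\sum_(q < m) G q))
          integral_along f (submultigraph (\sum_(q < m) G q) L)))%:E.
Proof.
move=> m0 _ gX X0 cf covX.
have fC := clamped_sym covX m0.
pose A := @exponents R m n Q.
pose c phi := \prod_(k < n) mcoeff (A phi k) Q.
pose W phi x := \sum_(h | admissible (a := A phi) h) wick_term f h x.
pose F x := \sum_phi c phi * W phi x.
have nW phi : nice (W phi) by apply: nice_sum => h; exact: nice_wick_term.
have ncW phi : nice (fun x => c phi * W phi x).
  by apply: niceM => //; exact: nice_cst.
have nF : nice F by exact: nice_sum.
have EF x : ('E_P[fun w => (\prod_(k < n)
    meval (fun i => X i (clamp (x k)) w) Q)%R] = (F x)%:E)%E.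
  rewrite unlock.
  pose mon phi w := \prod_(k < n) \prod_(i < m) X i (clamp (x k)) w ^+ A phi k i.
  transitivity (\int[P]_w (\sum_phi (c phi)%:E * (mon phi w)%:E))%E.
    apply: eq_integral => w _.
    by rewrite (prod_meval Q (fun k i => X i (clamp (x k)) w)) -sumEFin.
  have monE phi := expectation_monomial gX X0 covX (A phi) x m0.
  rewrite integral_sum//; last first.
    by move=> phi; apply: integrableZl => //; exact: (monE phi).1.
  rewrite -sumEFin; apply: eq_bigr => phi _.
  by rewrite integralZl//; [rewrite (monE phi).2|exact: (monE phi).1].
(* Symmetry is read off the expectation, where permuting the times only reorders the factors. *)
have symF (p : {perm 'I_n}) x : F (x \o p) = F x.
  apply: EFin_inj; rewrite -!EF; congr ('E_P[_])%E; apply/funext => w.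
  by rewrite [RHS](reindex_inj (@perm_inj _ p)).
have iterF := iter_int_symmetrize nF symF.
have n0 : n`!%:R != 0 :> R by rewrite pnatr_eq0 -lt0n fact_gt0.
(* On the cube [clamp] is the identity, and the ordering constraint becomes the factor
   [sorted_ind]. *)
transitivity (iter_int (enum 'I_n) (fun x => F x * sorted_ind x) (fun=> 0))%:E.
  rewrite -(@integral_lebesgue_tuple _ _ n); last 2 first.
  - by rewrite size_enum_ord.
  - by apply: niceM => //; exact: nice_sorted_ind.
  have -> : @ordered_simplex R n = @unit_cube R n `&`
      [set s | forall i j : 'I_n, (i <= j)%N -> tnth s i <= tnth s j] by [].
  rewrite integral_mkcondr; apply: eq_integral => s /set_mem s01.
  have -> : fill (enum 'I_n) s (fun=> 0) = tnth s.
    apply/funext => i; rewrite fillE ?enum_uniq ?size_tuple ?size_enum_ord ?card_ord//.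
    by rewrite mem_enum index_enum_ord (tnth_nth 0).
  rewrite patchE; case: ifPn => ss.
    transitivity (F (tnth s))%:E.
      rewrite -EF; congr ('E_P[_])%E; apply/funext => w; apply: eq_bigr => k _.
      by rewrite clamp_id//; exact: s01.
    rewrite sorted_indE (_ : [forall i, _]) ?mulr1//.
    apply/forallP => i; apply/forallP => j; apply/implyP; exact: (set_mem ss).
  rewrite sorted_indE; have [/forallP sij|_] := boolP
    [forall i : 'I_n, forall j : 'I_n, (i <= j)%N ==> (tnth s i <= tnth s j)];
    last by rewrite mulr0.
  case/negP: ss; apply/mem_set => i j ij.
  by have /forallP/(_ j)/implyP := sij i; apply.
congr EFin; apply: (mulfI n0); rewrite -iterF mulrA mulfV// mul1r.
rewrite fsbig_exponents; last first.
  move=> a oa; rewrite fsbig_graphs big_pred0// => h.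
  by apply/negP => /admissible_even; rewrite oa.
rewrite iter_int_sum//; apply: eq_bigr => phi _.
rewrite iter_intZ//; congr (_ * _); rewrite fsbig_graphs.
rewrite iter_int_sum; last by move=> h; exact: nice_wick_term.
by apply: eq_bigr => h adm; exact: iter_int_wick_term.
Qed.
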